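(* Let $\ell\ge3$ and let $L$ be a $\mathbb{Z}$-lattice on an $\ell$-dimensional $\mathbb{Q}$-vector space $V$ having a basis $\bm e_1,\dots,\bm e_\ell$ with $Q(\sum_jx_j\bm e_j)=\sum_ja_jx_j^2$, $a_j\in\mathbb{N}$ (a positive-definite diagonal quadratic form). Let $\bm u\in L$ be primitive with $Q(\bm u)\ne0$, and let $c\in\mathbb{N}$ be odd with $\gcd(d_L,Q(\bm u),c)=1$. Then \[\frac{m\left(L+\frac{\bm u}{c}\right)}{m(L)}\ \ge\ c^{\ell-1}\prod_{p\mid c}f_p.\] In particular, for every $\delta>0$ there exists a constant $C_\delta>0$ depending only on $\delta$ such that \[\frac{m\left(L+\frac{\bm u}{c}\right)}{m(L)}\ \ge\ C_\delta\, c^{\ell-1-\delta}.\]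
   Context: $d_L=a_1\cdots a_\ell$. $\bm u$ primitive means $\bm u\notin pL$ for all primes $p$. For an odd prime $p$, $f_3=\tfrac19$ and $f_p=\tfrac12-\tfrac3{2p}$ for $p\ge5$. $O(V)$ is the isometry group of $(V,Q)$, $V_p=V\otimes\mathbb{Q}_p$, $L_p=L\otimes\mathbb{Z}_p$. For a shifted lattice $K+\bm w$ ($K\subset V$ a lattice, $\bm w\in V$), $O(K+\bm w)$ is the group of $\sigma\in O(V)$ with $\sigma(K+\bm w)=K+\bm w$. Shifted lattices are in the same class if an element of $O(V)$ maps one onto the other, and in the same genus if for every prime $p$ an element of $O(V_p)$ maps the localization $K_p+\bm w$ of one onto that of the other. The Siegel mass is $m(K+\bm w)=\sum1/\#O(K'+\bm w')$ over class representatives $K'+\bm w'$ of the genus of $K+\bm w$; $m(L)$ is the case $\bm w=0$. *)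

(* Defs.v *)
From HB Require Import structures.
From mathcomp Require Import all_boot all_order all_algebra finmap.
From mathcomp Require Import all_classical all_reals all_analysis.

Set Implicit Arguments.
Unset Strict Implicit.
Unset Printing Implicit Defensive.

Import Order.TTheory GRing.Theory Num.Theory.
Local Open Scope classical_set_scope.
Local Open Scope ring_scope.

(* Z_p is the inverse limit of the rings Z/p^n: an element is the sequence of
   its least nonnegative residues modulo p^0, p^1, p^2, and so on. *)
Record padic_int (p : nat) (pr : prime p) := PadicInt {
  residue : nat -> nat;
  residueP : forall n,
    (residue n < p ^ n)%N /\ (residue n.+1 %% p ^ n)%N = residue n
}.
Arguments residue {p pr} _ _.

Section PadicIntegers.
Variables (p : nat) (pr : prime p).
Local Notation Zp := (padic_int pr).
Implicit Types x y z : Zp.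

Lemma padic_eq x y : (forall n, residue x n = residue y n) -> x = y.
Proof.
case: x y => [f fP] [g gP] /= fg; have {}fg : f = g by apply/funext.
by subst g; congr PadicInt; exact: Prop_irrelevance.
Qed.

HB.instance Definition _ := gen_eqMixin Zp.
HB.instance Definition _ := gen_choiceMixin Zp.

Let ppow_gt0 n : (0 < p ^ n)%N.
Proof. by rewrite expn_gt0 prime_gt0. Qed.

Let ppowS n : (p ^ n %| p ^ n.+1)%N.
Proof. by rewrite dvdn_exp2l. Qed.

Lemma residue_lt x n : (residue x n < p ^ n)%N.
Proof. by case: (residueP x n). Qed.

Lemma residue_small x n : (residue x n %% p ^ n)%N = residue x n.
Proof. by rewrite modn_small ?residue_lt. Qed.

Lemma residueS x n : (residue x n.+1 %% p ^ n)%N = residue x n.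
Proof. by case: (residueP x n). Qed.

Lemma residue_mod x n k : (residue x (n + k) %% p ^ n)%N = residue x n.
Proof.
elim: k => [|k IH]; first by rewrite addn0 residue_small.
rewrite addnS -IH -(residueS x (n + k)) modn_dvdm //.
by rewrite dvdn_exp2l ?leq_addr.
Qed.

Let reduceP (f : nat -> nat) :
  (forall n, f n.+1 = f n %[mod p ^ n]) ->
  forall n, (f n %% p ^ n < p ^ n)%N /\
    ((f n.+1 %% p ^ n.+1) %% p ^ n)%N = (f n %% p ^ n)%N.
Proof. by move=> fP n; rewrite ltn_mod ppow_gt0 modn_dvdm // fP. Qed.

Let nat_compat k n : k = k %[mod p ^ n]. Proof. by []. Qed.

Let add_compat x y n :
  residue x n.+1 + residue y n.+1 = residue x n + residue y n %[mod p ^ n].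
Proof. by rewrite -modnDm !residueS. Qed.

Let mul_compat x y n :
  residue x n.+1 * residue y n.+1 = residue x n * residue y n %[mod p ^ n].
Proof. by rewrite -modnMm !residueS. Qed.

Let opp_compat x n :
  p ^ n.+1 - residue x n.+1 = p ^ n - residue x n %[mod p ^ n].
Proof.
apply/eqP; rewrite -(eqn_modDr (residue x n.+1)) subnK; last first.
  exact: ltnW (residue_lt _ _).
rewrite -modnDmr residueS subnK; last exact: ltnW (residue_lt _ _).
by rewrite modnn (eqP (ppowS n)).
Qed.

Definition padic_nat (k : nat) : Zp := PadicInt pr (reduceP (nat_compat k)).
Definition padic_add x y : Zp := PadicInt pr (reduceP (add_compat x y)).
Definition padic_opp x : Zp := PadicInt pr (reduceP (opp_compat x)).
Definition padic_mul x y : Zp := PadicInt pr (reduceP (mul_compat x y)).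

Lemma padic_addA : associative padic_add.
Proof.
by move=> x y z; apply: padic_eq => n /=; rewrite modnDmr modnDml addnA.
Qed.

Lemma padic_addC : commutative padic_add.
Proof. by move=> x y; apply: padic_eq => n /=; rewrite addnC. Qed.

Lemma padic_add0 : left_id (padic_nat 0) padic_add.
Proof.
by move=> x; apply: padic_eq => n /=; rewrite mod0n add0n residue_small.
Qed.

Lemma padic_addN : left_inverse (padic_nat 0) padic_opp padic_add.
Proof.
move=> x; apply: padic_eq => n /=.
by rewrite modnDml subnK ?modnn ?mod0n // ltnW ?residue_lt.
Qed.

HB.instance Definition _ :=
  GRing.isZmodule.Build Zp padic_addA padic_addC padic_add0 padic_addN.

Lemma padic_mulA : associative padic_mul.
Proof.
by move=> x y z; apply: padic_eq => n /=; rewrite modnMmr modnMml mulnA.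
Qed.

Lemma padic_mulC : commutative padic_mul.
Proof. by move=> x y; apply: padic_eq => n /=; rewrite mulnC. Qed.

Lemma padic_mul1 : left_id (padic_nat 1) padic_mul.
Proof.
by move=> x; apply: padic_eq => n /=; rewrite modnMml mul1n residue_small.
Qed.

Lemma padic_mulD : left_distributive padic_mul padic_add.
Proof.
by move=> x y z; apply: padic_eq => n /=; rewrite modnMml modnDm mulnDl.
Qed.

Lemma padic_1neq0 : padic_nat 1 != padic_nat 0.
Proof.
apply/eqP => /(congr1 (fun x : Zp => residue x 1)) /=.
by rewrite expn1 mod0n modn_small ?prime_gt1.
Qed.

HB.instance Definition _ := GRing.Zmodule_isComNzRing.Build Zp
  padic_mulA padic_mulC padic_mul1 padic_mulD padic_1neq0.

Definition padic_unit : {pred Zp} :=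
  fun x => `[< exists y : Zp, y * x = 1 >].
Definition padic_inv x : Zp := xget x [set y : Zp | y * x = 1].

Lemma padic_mulV : {in padic_unit, left_inverse 1 padic_inv *%R}.
Proof.
move=> x /asboolP xU; rewrite /padic_inv.
by case: xgetP => [y _ //|none]; case: xU => y yx; case: (none y).
Qed.

Lemma padic_unitP x y : y * x = 1 -> padic_unit x.
Proof. by move=> yx; apply/asboolP; exists y. Qed.

Lemma padic_inv_out : {in [predC padic_unit], padic_inv =1 id}.
Proof.
move=> x /asboolP xNU; rewrite /padic_inv.
by case: xgetP => [y _ yx|//]; case: xNU; exists y.
Qed.

HB.instance Definition _ := GRing.ComNzRing_hasMulInverse.Build Zp
  padic_mulV padic_unitP padic_inv_out.

Lemma padic_neq0 x :
  x != 0 -> exists m, ~~ (p ^ m %| residue x m)%N.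
Proof.
move=> x0; apply: contrapT => /forallNP xN; case/eqP: x0.
apply: padic_eq => n; rewrite /= mod0n -residue_small.
by apply/eqP; move/negP: (xN n); rewrite negbK.
Qed.

(* The last residue of x that vanishes, and the next one. *)
Let padic_val x : x != 0 ->
  exists m, (p ^ m %| residue x m.+1)%N /\ ~~ (p ^ m.+1 %| residue x m.+1)%N.
Proof.
move=> x0; have xN := padic_neq0 x0.
case: (ex_minnP xN) => -[|m] mN mmin; first by rewrite dvd1n in mN.
exists m; split=> //.
have : ~~ ~~ (p ^ m %| residue x m)%N.
  by apply/negP => /mmin; rewrite ltnn.
by rewrite negbK /dvdn -(residueS x m) modn_mod.
Qed.

Lemma padic_integral : GRing.integral_domain_axiom Zp.
Proof.
move=> x y xy0; apply: contrapT => /negP; rewrite negb_or => /andP[x0 y0].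
have [m [xm xm1]] := padic_val x0; have [n [yn yn1]] := padic_val y0.
set N := (m + n).+1.
have vx k : (k <= m.+1)%N ->
    (p ^ k %| residue x m.+1)%N = (p ^ k %| residue x N)%N.
  move=> km; have -> : N = (m.+1 + n)%N by rewrite /N addSn.
  by rewrite -(residue_mod x m.+1 n) /dvdn modn_dvdm // dvdn_exp2l.
have vy k : (k <= n.+1)%N ->
    (p ^ k %| residue y n.+1)%N = (p ^ k %| residue y N)%N.
  move=> kn; have -> : N = (n.+1 + m)%N by rewrite /N addSn addnC.
  by rewrite -(residue_mod y n.+1 m) /dvdn modn_dvdm // dvdn_exp2l.
rewrite !vx // in xm xm1; rewrite !vy // in yn yn1.
have /= := congr1 (fun z : Zp => residue z N) xy0; rewrite mod0n => /eqP.
case/dvdnP: xm xm1 => a ->; case/dvdnP: yn yn1 => b ->.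
rewrite /N mulnACA -expnD !expnS -/(dvdn _ _) !dvdn_pmul2r ?ppow_gt0 //.
by move=> pb pa; rewrite Euclid_dvdM // (negPf pa) (negPf pb).
Qed.

HB.instance Definition _ := GRing.ComUnitRing_isIntegral.Build Zp padic_integral.

End PadicIntegers.

Notation padic pr := {fraction padic_int pr}.

(* A rational quadratic space of dimension n is given as V = Q^n (row vectors)
   with the form Q(v) = v G v^T, and linear maps act on V by right
   multiplication.  Its extension V_p is Q_p^n with the same matrix G. *)
Section QuadraticSpaces.
Variables (F : fieldType) (n : nat) (G : 'M[F]_n).

Definition qform (v : 'rV[F]_n) : F := (v *m G *m v^T) 0 0.

Definition isometries : set 'M[F]_n :=
  [set s | s \in unitmx /\ forall v, qform (v *m s) = qform v].

Definition carries (s : 'M[F]_n) (X Y : set 'rV[F]_n) : Prop :=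
  [set v *m s | v in X] = Y.

Definition translate (K : set 'rV[F]_n) (w : 'rV[F]_n) : set 'rV[F]_n :=
  [set k + w | k in K].

End QuadraticSpaces.

Section ShiftedLattices.
Variable n : nat.
Implicit Types (E : 'M[rat]_n) (K X Y : set 'rV[rat]_n) (u w : 'rV[rat]_n).

Definition zspan E : set 'rV[rat]_n :=
  [set map_mx intr z *m E | z in [set: 'rV[int]_n]].

Definition lattice K : Prop := exists2 E, E \in unitmx & K = zspan E.

Definition primitive K u : Prop :=
  K u /\ forall p, prime p -> ~ exists2 v, K v & u = p%:R *: v.

Section Local.
Variables (p : nat) (pr : prime p).

Definition localize w : 'rV[padic pr]_n := map_mx ratr w.

(* K_p = K (x) Z_p inside V_p: the Z_p-span of K. *)
Definition local_lattice K : set 'rV[padic pr]_n :=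
  [set v | exists (m : nat) (k : 'I_m -> 'rV[rat]_n) (z : 'I_m -> padic_int pr),
     (forall i, K (k i)) /\ v = \sum_(i < m) tofrac (z i) *: localize (k i)].

End Local.

Arguments localize {p} pr w.
Arguments local_lattice {p} pr K.

Variable G : 'M[rat]_n.

(* The genus of K + w; its members are the cosets K' + w' as subsets of V. *)
Definition genus K w : set (set 'rV[rat]_n) :=
  [set X | exists K' w', [/\ lattice K', X = translate K' w' &
     forall (p : nat) (pr : prime p),
       exists2 s, isometries (map_mx ratr G : 'M[padic pr]_n) s &
         carries s (translate (local_lattice pr K) (localize pr w))
                   (translate (local_lattice pr K') (localize pr w'))]].

Definition class X : set (set 'rV[rat]_n) :=
  [set Y | exists2 s, isometries G s & carries s X Y].

(* A canonical element of the class of X. *)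
Definition class_rep X : set 'rV[rat]_n := get (class X).

Definition autos X : set 'M[rat]_n :=
  [set s | isometries G s /\ carries s X X].

(* The groups and the set of classes are finite for positive definite G, so
   the junk values of fset_set and of the finitely supported sum are not used. *)
Definition mass K w : rat :=
  \sum_(X \in class_rep @` genus K w) (#|` fset_set (autos X)|%:R : rat)^-1.

End ShiftedLattices.

(* Only used at odd primes. *)
Definition fp (p : nat) : rat :=
  if p == 3 then 9%:R^-1 else 2%:R^-1 - 3%:R / (2 * p)%:R.

(* Main.v *)
Require Import Defs.
From HB Require Import structures.
From mathcomp Require Import all_boot all_order all_algebra finmap.
From mathcomp Require Import ring lra zify.
From mathcomp Require Import all_classical all_reals all_analysis.

(** In coordinates, a coset K' + w' of the genus of L + u/c is a basis of K' with
    integral Gram matrix A' and an integer vector z' modulo c such that over every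
    Z_p some invertible U carries (A', z') to (A, z).  Hermite reduction leaves
    finitely many pairs (A', z' mod c) up to isometry.
    For a lattice K' of the genus of L the group O(K') acts on the cosets of K'
    in the genus of L + u/c, with stabilizers O(K' + w'), so it suffices to find
    at least c^(l-1) prod_(p | c) (1 - 2/p) such cosets for each K'.
    They come from reflections: if 2 B(u, w) = 1 and Q(w) is a unit modulo c, the
    reflection in w moves u to u - w / Q(w), and this vector determines w.  Lines
    in a fixed direction inside the hyperplane 2 B(u, w) = 1 reduce the count of
    these w to the values of a quadratic polynomial that vanishes modulo no p | c.
    Finally f_p <= 1 - 2/p, and f_p >= 1/9 >= p^(-delta) for all large p. *)

Set Implicit Arguments.
Unset Strict Implicit.
Unset Printing Implicit Defensive.

Import Order.TTheory GRing.Theory Num.Theory.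
Local Open Scope classical_set_scope.
Local Open Scope ring_scope.

(** * Arithmetic of the p-adic integers *)

(** A reflection is an explicit isometry of L_p, integral as soon as Q(w) is a unit of Z_p, so no
    local classification or lifting of solutions enters. Only vectors modulo c matter: one integer
    vector represents the images of u under the p-adic reflections for all p | c at once, and at the
    other primes u/c already lies in L_p. A lattice K' of the genus is tied to L only by unrelated
    local isometries U_p; one integer matrix congruent to all of them modulo c carries the reflected
    vectors into coordinates of K' and stays injective modulo c. The hyperplane 2 B(u, w) = 1 has
    c^(l-1) points, and a nonzero polynomial of degree at most 2 has at most two roots in F_p,
    whence the factors 1 - 2/p. The gcd condition, primitivity and oddness of c enter through a
    single fact: for each p | c some w has both 2 B(u, w) and Q(w) nonzero modulo p. Finiteness of
    classes and of automorphism groups has to be proved because the sum and the cardinals that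
    define the mass would otherwise take default values. *)

Lemma subf_div_cross (F : fieldType) (a b c d : F) : c != 0 -> d != 0 ->
  (a * d - b * c) / (c * d) = a / c - b / d.
Proof. by move=> c0 d0; field; rewrite c0 d0. Qed.

Section PadicArithmetic.
Variables (p : nat) (pr : prime p).
Local Notation Zp := (padic_int pr).

Let ppow_gt0 n : (0 < p ^ n)%N.
Proof. by rewrite expn_gt0 prime_gt0. Qed.

Lemma residue_natr k n : residue (k%:R : Zp) n = (k %% p ^ n)%N.
Proof.
elim: k => [|k IH]; first by rewrite mulr0n.
by rewrite -addn1 natrD /= IH modnDm.
Qed.

(** Completeness of Z_p: quotients and inverses are built below as sequences of naturals compatible
    modulo the powers of p. *)
Lemma padic_limit (f : nat -> nat) :
  (forall n, f n.+1 = f n %[mod p ^ n]) ->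
  exists x : Zp, forall n, residue x n = (f n %% p ^ n)%N.
Proof.
move=> fP; have H n : (f n %% p ^ n < p ^ n)%N /\
    ((f n.+1 %% p ^ n.+1) %% p ^ n)%N = (f n %% p ^ n)%N.
  by rewrite ltn_mod ppow_gt0 modn_dvdm ?dvdn_exp2l // fP.
by exists (PadicInt pr H).
Qed.

Lemma padic_dvd_residue (x : Zp) k :
  exists y : Zp, x = (residue x k)%:R + (p ^ k)%:R * y.
Proof.
(* The n-th residue of the quotient is read off from the residue of x modulo p^(k + n). *)
have [n|y yE] := @padic_limit (fun n => residue x (k + n) %/ p ^ k)%N.
  rewrite -(residue_mod x (k + n) 1) addn1 addnS expnD.
  set a := residue x _.
  rewrite {1}(divn_eq a (p ^ k * p ^ n)) mulnCA mulnC divnMDl //.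
  by rewrite modnMDl.
exists y; apply: padic_eq => n.
have -> : residue ((residue x k)%:R + (p ^ k)%:R * y) n =
   ((residue x k + p ^ k * (residue x (k + n) %/ p ^ k)) %% p ^ n)%N.
  rewrite /= !residue_natr yE modnDml.
  by rewrite modnDmr -modnDmr modnMml modnMmr modnDmr.
rewrite -(residue_mod x k n) mulnC addnC -divn_eq addnC.
by rewrite (residue_mod x n k).
Qed.

Lemma padic_natr_eq0 k : (k%:R == 0 :> Zp) = (k == 0)%N.
Proof.
apply/eqP/eqP => [|-> //] /(congr1 (fun x : Zp => residue x k)).
rewrite residue_natr /= mod0n modn_small //.
exact: ltn_expl (prime_gt1 pr).
Qed.

Lemma padic_intr_eq0 (k : int) : (k%:~R == 0 :> Zp) = (k == 0).
Proof.
case: k => k; first by rewrite -pmulrn padic_natr_eq0.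
by rewrite NegzE mulrNz !oppr_eq0 -pmulrn padic_natr_eq0.
Qed.

(** Chinese remaindering yields a multiple of k congruent to 1 modulo p^n; its quotient by k
    represents the n-th residue of the inverse. *)
Lemma padic_natr_unit k : coprime p k -> (k%:R : Zp) \is a GRing.unit.
Proof.
move=> pk; have kn n : coprime k (p ^ n) by rewrite coprime_sym coprimeXl.
pose f n := (chinese k (p ^ n) 0 1 %/ k)%N.
have fE n : (k * f n = 1 %[mod p ^ n])%N.
  have kd : (k %| chinese k (p ^ n) 0 1)%N.
    by rewrite /dvdn chinese_modl ?mod0n.
  by rewrite mulnC divnK // chinese_modr.
have [n|y yE] := @padic_limit f.
  have h : (k * f n.+1 = k * f n %[mod p ^ n])%N.
    rewrite fE -(modn_dvdm (k * f n.+1) (dvdn_exp2l p (leqnSn n))) fE.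
    by rewrite modn_dvdm ?dvdn_exp2l.
  have := congr1 (fun a => (f n * a) %% p ^ n)%N h; rewrite /= !modnMmr.
  rewrite !mulnA (mulnC _ k) -[LHS]modnMml -[RHS]modnMml fE !modnMml !mul1n.
  by [].
apply/unitrPr; exists y; apply: padic_eq => n /=.
by rewrite residue_natr yE modnMml modnMmr fE.
Qed.

Lemma padic_intr_unit (k : int) :
  coprime p `|k|%N -> (k%:~R : Zp) \is a GRing.unit.
Proof.
case: k => k; first by rewrite -pmulrn; exact: padic_natr_unit.
by rewrite NegzE mulrNz unitrN -pmulrn abszN; exact: padic_natr_unit.
Qed.

Lemma padic_dvd_intr (k : int) (x : Zp) : k%:~R = p%:R * x -> (p %| `|k|)%N.
Proof.
case: k => k; rewrite ?NegzE ?abszN /=.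
  move/(congr1 (fun x : Zp => residue x 1)).
  rewrite -pmulrn residue_natr /= residue_natr expn1 modnn mul0n mod0n.
  by move/eqP.
move=> h; have : k.+1%:R = p%:R * - x by rewrite mulrN -h mulrNz opprK -pmulrn.
move/(congr1 (fun x : Zp => residue x 1)).
rewrite residue_natr /= residue_natr expn1 modnn mul0n mod0n.
by move/eqP.
Qed.

(* Division by c in Z_p only sees the p-part of c. *)
Lemma padic_approx (x : Zp) c : (0 < c)%N ->
  exists y : Zp, x = (residue x (logn p c))%:R + c%:R * y.
Proof.
move=> c0; have [y xE] := padic_dvd_residue x (logn p c).
have [m pm cE] := pfactor_coprime pr c0.
have mU := padic_natr_unit pm.
exists (y / m%:R); rewrite {1}xE; congr (_ + _).
rewrite [in RHS]cE natrM [m%:R * _]mulrC -mulrA; congr (_ * _).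
by rewrite mulrCA mulrV ?mulr1.
Qed.

(** The embedding of Q into Q_p, under a name that carries the ring morphism structure established
    below. That structure rests on nonzero integers staying nonzero in Q_p. *)
Definition ratp : rat -> padic pr := ratr.

Lemma padic_frac_intr_eq0 (k : int) : (k%:~R == 0 :> padic pr) = (k == 0).
Proof.
have -> : k%:~R = tofrac (k%:~R : Zp) by rewrite rmorph_int.
by rewrite tofrac_eq0 padic_intr_eq0.
Qed.

Lemma ratp_div (x : rat) (a b : int) :
  b != 0 -> x * b%:~R = a%:~R -> ratp x = a%:~R / b%:~R.
Proof.
move=> b0 xb; rewrite /ratp /ratr.
have d0 : (denq x)%:~R != 0 :> padic pr by rewrite padic_frac_intr_eq0 denq_eq0.
have e : numq x * b = a * denq x.
  apply: (@intr_inj rat); rewrite !intrM -xb mulrAC; congr (_ * _).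
  by rewrite numqE.
apply/eqP; rewrite eqr_div ?padic_frac_intr_eq0 // -!intrM e //.
Qed.

Lemma ratp_denq x : x * (denq x)%:~R = (numq x)%:~R.
Proof. by rewrite numqE. Qed.

Fact ratp_is_zmod_morphism : zmod_morphism ratp.
Proof.
move=> x y; rewrite (@ratp_div _ (numq x * denq y - numq y * denq x) (denq x * denq y));
  [|by rewrite mulf_neq0 ?denq_eq0|]; last first.
  by rewrite rmorphB !rmorphM /= -!ratp_denq; ring.
rewrite rmorphB !rmorphM /= /ratp /ratr.
have dx : (denq x)%:~R != 0 :> padic pr by rewrite padic_frac_intr_eq0 denq_eq0.
have dy : (denq y)%:~R != 0 :> padic pr by rewrite padic_frac_intr_eq0 denq_eq0.
exact: (subf_div_cross (F := padic pr)).
Qed.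

HB.instance Definition _ :=
  GRing.isZmodMorphism.Build rat (padic pr) ratp ratp_is_zmod_morphism.

Fact ratp_is_monoid_morphism : monoid_morphism ratp.
Proof.
split=> [|x y].
  by rewrite (@ratp_div _ 1 1) ?divr1 // mulr1.
rewrite (@ratp_div _ (numq x * numq y) (denq x * denq y));
  [|by rewrite mulf_neq0 ?denq_eq0|]; last first.
  by rewrite !rmorphM /= -!ratp_denq; ring.
by rewrite !rmorphM /= /ratp /ratr invfM mulrACA.
Qed.

HB.instance Definition _ :=
  GRing.isMonoidMorphism.Build rat (padic pr) ratp ratp_is_monoid_morphism.

Lemma fracp_inj : injective (@tofrac Zp).
Proof. by move=> x y /eqP; rewrite tofrac_eq => /eqP. Qed.

Lemma ratp_int k : ratp k%:~R = tofrac (k%:~R).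
Proof. by rewrite !rmorph_int. Qed.

(** If p divided the denominator, then the numerator, equal to x times the denominator in Z_p, would
    be divisible by p as well, against lowest terms. *)
Lemma ratp_denq_coprime (r : rat) (x : Zp) :
  ratp r = tofrac x -> ~~ (p %| `|denq r|)%N.
Proof.
move=> rx; apply/negP => pd.
have h : (numq r)%:~R = x * (denq r)%:~R.
  by apply: fracp_inj; rewrite rmorphM /= -rx -!ratp_int -rmorphM /= ratp_denq.
have [k dE] : exists k : int, denq r = p%:Z * k.
  by case/dvdzP: (pd : (p%:Z %| denq r)%Z) => k ->; exists k; rewrite mulrC.
have pn : (p %| `|numq r|)%N.
  apply: (@padic_dvd_intr _ (x * k%:~R)).
  by rewrite h dE rmorphM /= -pmulrn mulrCA.
have := coprime_num_den r; rewrite /coprime => /eqP g1.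
have : (p %| gcdn `|numq r| `|denq r|)%N by rewrite dvdn_gcd pn.
by rewrite g1 dvdn1; move/eqP => p1; move: pr; rewrite p1.
Qed.

End PadicArithmetic.

(** A prime factor of the denominator would contradict integrality at that prime. All passages from
    local to global integrality below reduce to this. *)
Lemma rat_int_local (r : rat) :
  (forall p (pr : prime p), exists x : padic_int pr, ratp pr r = tofrac x) ->
  exists k : int, r = k%:~R.
Proof.
move=> H; have d1 : `|denq r|%N = 1%N.
  apply/eqP; rewrite eqn_leq absz_gt0 denq_eq0 andbT leqNgt.
  apply/negP => d; have pd := pdiv_dvd `|denq r|%N.
  have [x /ratp_denq_coprime] := H _ (pdiv_prime d).
  by rewrite pd.
have d1' : denq r = 1 by rewrite -[denq r]gtz0_abs ?denq_gt0 // d1.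
by exists (numq r); rewrite -ratp_denq d1' mulr1.
Qed.

Lemma rat_mx_int_local m n (X : 'M[rat]_(m, n)) :
  (forall p (pr : prime p), exists Y : 'M[padic_int pr]_(m, n),
     map_mx (ratp pr) X = map_mx (@tofrac _) Y) ->
  exists Z : 'M[int]_(m, n), X = map_mx intr Z.
Proof.
move=> H; have h i j : exists k : int, X i j = k%:~R.
  apply: rat_int_local => p pr; have [Y /matrixP/(_ i j)] := H p pr.
  by rewrite !mxE => ->; exists (Y i j).
have [f fE] := choice (fun ij : 'I_m * 'I_n => h ij.1 ij.2).
by exists (\matrix_(i, j) f (i, j)); apply/matrixP => i j; rewrite !mxE -fE.
Qed.

(** * The genus in coordinates *)

Section SymmetricPart.
Variables (F : fieldType) (n : nat).
Hypothesis two_neq0 : 2%:R != 0 :> F.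
Implicit Types (G M : 'M[F]_n) (v : 'rV[F]_n).

(** [G] is an arbitrary square matrix, and Q determines only its symmetric part: the Gram matrix of
    the bilinear form B with B(x, x) = Q(x). *)
Definition sym_part G : 'M[F]_n := 2%:R^-1 *: (G + G^T).

Lemma sym_part_tr G : (sym_part G)^T = sym_part G.
Proof. by rewrite linearZ /= linearD /= trmxK addrC. Qed.

Lemma qform_tr G v : (v *m G^T *m v^T) 0 0 = qform G v.
Proof.
have -> : v *m G^T *m v^T = (v *m G *m v^T)^T by rewrite !trmx_mul trmxK mulmxA.
by rewrite mxE.
Qed.

Lemma qform_sym_part G v : qform G v = (v *m sym_part G *m v^T) 0 0.
Proof.
rewrite -scalemxAr -scalemxAl mulmxDr mulmxDl mxE [in RHS]mxE qform_tr.
by rewrite /qform -mulr2n -[X in _ * X]mulr_natl mulrA mulVf // mul1r.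
Qed.

Lemma delta_form M i j :
  ((delta_mx 0 i : 'rV_n) *m M *m (delta_mx 0 j : 'rV_n)^T) 0 0 = M i j.
Proof. by rewrite -rowE trmx_delta -colE !mxE. Qed.

(** Polarization: once the diagonal vanishes, the value at e_i + e_j is twice the entry (i, j). *)
Lemma form_eq0 M : M^T = M -> (forall v, (v *m M *m v^T) 0 0 = 0) -> M = 0.
Proof.
move=> Ms M0; apply/matrixP => i j; rewrite [RHS]mxE.
have := M0 (delta_mx 0 i + delta_mx 0 j).
rewrite linearD /= mulmxDr !mulmxDl [X in X = 0]mxE [X in X + _]mxE.
rewrite [X in _ + X]mxE !delta_form.
have d k : M k k = 0 by rewrite -delta_form M0.
have -> : M j i = M i j by rewrite -{1}Ms mxE.
rewrite !d add0r addr0 -mulr2n -mulr_natl => /eqP.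
by rewrite mulf_eq0 (negPf two_neq0) => /eqP.
Qed.

Lemma isometriesP G s : isometries G s <->
  s \in unitmx /\ s *m sym_part G *m s^T = sym_part G.
Proof.
split=> -[sU sG]; split=> //.
  apply/eqP; rewrite -subr_eq0; apply/eqP/form_eq0.
    by rewrite linearB /= !trmx_mul trmxK sym_part_tr mulmxA.
  move=> v; rewrite mulmxBr mulmxBl mxE [X in _ + X]mxE -qform_sym_part -sG.
  by rewrite qform_sym_part trmx_mul !mulmxA subrr.
by move=> v; rewrite !qform_sym_part trmx_mul -[in RHS]sG !mulmxA.
Qed.

End SymmetricPart.

Lemma padic_two_neq0 p (pr : prime p) : 2%:R != 0 :> padic pr.
Proof. by have := padic_frac_intr_eq0 pr 2 => /= ->. Qed.

Lemma padic_natr_neq0 p (pr : prime p) c : (0 < c)%N -> c%:R != 0 :> padic pr.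
Proof. by have := padic_frac_intr_eq0 pr c => /= ->; rewrite -lt0n. Qed.

Lemma scaled_coordP (F : fieldType) n (k : F) (a b y : 'rV[F]_n) (U : 'M[F]_n) :
  k != 0 -> (k^-1 *: a *m U = b + y <-> a *m U = k *: b + k *: y).
Proof.
move=> k0; rewrite -scalemxAl -scalerDr; split=> [<-|->].
  by rewrite scalerA mulfV // scale1r.
by rewrite scalerA mulVf // scale1r.
Qed.

(** * Isometries between lattice cosets as invertible matrices over the base ring *)

Section IsometryCoordinates.
Variables (F : fieldType) (D : comUnitRingType) (j : {rmorphism D -> F}) (n : nat).
Hypothesis j_inj : injective j.
Local Notation "M ^j" := (map_mx j M) (at level 2, format "M ^j").

Definition free_module (e : 'M[F]_n) : set 'rV[F]_n :=
  [set y^j *m e | y in [set: 'rV[D]_n]].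

Lemma map_unitmx_rmorph (U : 'M[D]_n) : U \in unitmx -> U^j \in unitmx.
Proof. by rewrite !unitmxE det_map_mx => /(rmorph_unit j). Qed.

Lemma map_mx_inj m k : injective (fun M : 'M[D]_(m, k) => M^j).
Proof.
move=> M N /matrixP H; apply/matrixP => a b.
by have := H a b; rewrite !mxE => /j_inj.
Qed.

(** A form that becomes integral after an invertible integral change of basis was integral before
    it; this gives the local integrality of Gram matrices in the genus. *)
Lemma conj_unit_int (U A : 'M[D]_n) (B : 'M[F]_n) : U \in unitmx ->
  U^j *m B *m U^j^T = A^j -> B = (invmx U *m A *m (invmx U)^T)^j.
Proof.
move=> UU UA; rewrite !map_mxM -UA !mulmxA -map_mxM mulVmx // map_mx1 mul1mx.
rewrite -mulmxA -map_trmx -trmx_mul -map_mxM mulVmx //.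
by rewrite map_mx1 trmx1 mulmx1.
Qed.

(** Subtracting the image of the base point leaves the linear part of the map, whose values on the
    basis vectors are the rows of [U]. It serves over Z_p for the genus and over Z for
    automorphisms. *)
Lemma lattice_map_coord (E E' s : 'M[F]_n) (a b : 'rV[F]_n) :
  (forall z : 'rV[D]_n, exists y : 'rV[D]_n,
     (map_mx j z *m E + a) *m s = map_mx j y *m E' + b) ->
  exists U : 'M[D]_n, exists y : 'rV[D]_n,
    E *m s = map_mx j U *m E' /\ a *m s = map_mx j y *m E' + b.
Proof.
move=> /choice[f fE].
have f0 := fE 0; rewrite map_mx0 mul0mx add0r in f0.
exists (\matrix_i (f (delta_mx 0 i) - f 0)), (f 0); split=> //.
apply/row_matrixP => i; rewrite !row_mul; move: (fE (delta_mx 0 i)).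
rewrite map_delta_mx -rowE mulmxDl f0 => /eqP.
rewrite addrA (can_eq (addrK _)) => /eqP/(canRL (addrK _)) ->.
rewrite -mulmxBl; congr (_ *m _); apply/rowP => k.
by rewrite !mxE rmorphB.
Qed.

(** [U] is the matrix of s with respect to the two bases. That s maps one coset into the other makes
    it integral; the same argument for the inverse of s makes it invertible over [D]. *)
Lemma isometry_coordP (S eE eE' : 'M[F]_n) (t t' : 'rV[F]_n) :
  eE \in unitmx -> eE' \in unitmx ->
  (exists2 s, s \in unitmx /\ s *m S *m s^T = S &
     carries s (translate (free_module eE) (t *m eE))
               (translate (free_module eE') (t' *m eE')))
  <->
  (exists (U : 'M[D]_n) (y : 'rV[D]_n), [/\ U \in unitmx,
     U^j *m (eE' *m S *m eE'^T) *m (U^j)^T = eE *m S *m eE^T &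
     t *m U^j = t' + y^j]).
Proof.
move=> eEU eE'U; split.
  move=> [s sI sC]; have [sU sG] := sI.
  have [U [y [UE yE]]] : exists U : 'M[D]_n, exists y : 'rV[D]_n,
      eE *m s = U^j *m eE' /\
      (t *m eE) *m s = map_mx j y *m eE' + t' *m eE'.
    apply: lattice_map_coord => z.
    have : (translate (free_module eE') (t' *m eE'))
       ((map_mx j z *m eE + t *m eE) *m s).
      by rewrite -sC; exists (map_mx j z *m eE + t *m eE) => //;
        exists (map_mx j z *m eE) => //; exists z.
    by move=> [_ [y _ <-] <-]; exists y.
  have [U' [y' [U'E _]]] : exists U : 'M[D]_n, exists y : 'rV[D]_n,
      eE' *m invmx s = U^j *m eE /\
      (t' *m eE') *m invmx s = map_mx j y *m eE + t *m eE.
    apply: lattice_map_coord => z.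
    have : [set v *m s | v in translate (free_module eE) (t *m eE)]
       (map_mx j z *m eE' + t' *m eE').
      by rewrite sC; exists (map_mx j z *m eE') => //; exists z.
    by move=> [_ [_ [y' _ <-] <-] <-]; exists y'; rewrite mulmxK.
  have UU : U *m U' = 1%:M.
    have : map_mx j (U *m U') = 1%:M.
      rewrite map_mxM -[LHS](mulmxK eEU) -(mulmxA (U^j)) -U'E.
      by rewrite mulmxA -UE mulmxK // mulmxV.
    by rewrite -(map_mx1 j) => /map_mx_inj.
  exists U, y; split.
  - by case: (mulmx1_unit UU).
  - rewrite !mulmxA -UE -!mulmxA -trmx_mul -UE trmx_mul.
    by rewrite -[in RHS]sG !mulmxA.
  - apply: (can_inj (mulmxK eE'U)).
    by rewrite -mulmxA -UE mulmxA yE mulmxDl addrC.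
move=> [U [y [UU UG yE]]].
have jUU := map_unitmx_rmorph UU.
pose s := invmx eE *m U^j *m eE'.
have sU : s \in unitmx by rewrite !unitmx_mul unitmx_inv eEU jUU.
have Es : eE *m s = U^j *m eE' by rewrite /s !mulmxA mulmxV ?mul1mx.
exists s.
  split=> //.
  apply: (can_inj (mulKmx eEU)); apply: (can_inj (mulmxK (_ : eE^T \in unitmx))).
    by rewrite unitmx_tr.
  move: UG; rewrite !mulmxA -Es => <-; rewrite -!mulmxA -!trmx_mul -Es.
  by rewrite trmx_mul !mulmxA.
have tE : t *m eE *m s = map_mx j y *m eE' + t' *m eE'.
  by rewrite -mulmxA Es mulmxA yE mulmxDl addrC.
apply/seteqP; split=> v /=.
  move=> [_ [_ [z _ <-] <-] <-].
  exists (map_mx j (z *m U + y) *m eE'); first by exists (z *m U + y).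
  by rewrite map_mxD map_mxM !mulmxDl tE -!mulmxA Es addrA.
move=> [_ [z _ <-] <-].
exists (map_mx j ((z - y) *m invmx U) *m eE + t *m eE).
  by exists (map_mx j ((z - y) *m invmx U) *m eE) => //; exists ((z - y) *m invmx U).
rewrite mulmxDl tE -mulmxA Es mulmxA -map_mxM mulmxKV // addrA -mulmxDl -map_mxD.
by rewrite subrK.
Qed.

End IsometryCoordinates.

Lemma map_ratp_int p (pr : prime p) m n (A : 'M[int]_(m, n)) :
  map_mx (ratp pr) (map_mx intr A) = map_mx (@tofrac _) (map_mx intr A).
Proof. by apply/matrixP => a b; rewrite !mxE ratp_int. Qed.

Section LocalCoordinates.
Variables (n p : nat) (pr : prime p).
Local Notation Zp := (padic_int pr).
Local Notation j := (@tofrac Zp).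
Local Notation iota := (ratp pr).

Lemma local_zspan (E : 'M[rat]_n) : local_lattice (pr:=pr) (zspan E) =
  [set map_mx j y *m map_mx iota E | y in [set: 'rV[Zp]_n]].
Proof.
apply/seteqP; split=> v /=.
  move=> [m [k [z [kE ->]]]].
  have /choice[t tE] i : exists y, map_mx intr y *m E = k i.
    by have [y _ yE] := kE i; exists y.
  exists (\sum_(i < m) z i *: map_mx intr (t i)) => //.
  rewrite raddf_sum mulmx_suml; apply: eq_bigr => i _ /=.
  rewrite -tE [localize _ _](_ : _ = map_mx iota (map_mx intr (t i) *m E)) //.
  rewrite map_mxM map_mxZ -scalemxAl; congr (_ *: (_ *m _)).
  exact/esym/map_ratp_int.
move=> [y _ <-]; exists n, (fun i => row i E), (fun i => y 0 i); split.
  move=> i; exists (delta_mx 0 i) => //.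
  by rewrite map_delta_mx -rowE.
rewrite mulmx_sum_row; apply: eq_bigr => i _; rewrite !mxE; congr (_ *: _).
by apply/matrixP => a b; rewrite !mxE.
Qed.

Lemma local_isometryP (G E E' : 'M[rat]_n) (t t' : 'rV[rat]_n) :
  E \in unitmx -> E' \in unitmx ->
  (exists2 s, isometries (map_mx ratr G : 'M[padic pr]_n) s &
     carries s (translate (local_lattice (pr:=pr) (zspan E)) (localize pr (t *m E)))
               (translate (local_lattice (pr:=pr) (zspan E')) (localize pr (t' *m E'))))
  <->
  (exists (U : 'M[Zp]_n) (y : 'rV[Zp]_n), [/\ U \in unitmx,
     map_mx j U *m map_mx iota (E' *m sym_part G *m E'^T) *m (map_mx j U)^T
       = map_mx iota (E *m sym_part G *m E^T) &
     map_mx iota t *m map_mx j U = map_mx iota t' + map_mx j y]).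
Proof.
move=> EU E'U; 
have eEU : map_mx iota E \in unitmx by rewrite map_unitmx.
have eE'U : map_mx iota E' \in unitmx by rewrite map_unitmx.
have two := padic_two_neq0 pr.
have GS : sym_part (map_mx iota G) = map_mx iota (sym_part G).
  rewrite /sym_part map_mxZ map_mxD map_trmx; congr (_ *: _).
  by rewrite fmorphV rmorph_nat.
have iB (H : 'M[rat]_n) : map_mx iota (H *m sym_part G *m H^T) =
    map_mx iota H *m sym_part (map_mx iota G) *m (map_mx iota H)^T.
  by rewrite !map_mxM GS map_trmx.
have loc (v : 'rV[rat]_n) (H : 'M[rat]_n) : translate (local_lattice (pr:=pr) (zspan H)) (localize pr (v *m H)) =
   translate (free_module j (map_mx iota H)) (map_mx iota v *m map_mx iota H).
  by rewrite -map_mxM local_zspan.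
rewrite !iB !loc.
have := isometry_coordP (@fracp_inj p pr) (sym_part (map_mx iota G)) (map_mx iota t) (map_mx iota t') eEU eE'U.
move=> H; split=> [[s /(isometriesP two) sI sC]|/H.2[s sI sC]].
  by apply: H.1; exists s.
exists s; last exact: sC.
by apply: (isometriesP two _ _).2; exact: sI.
Qed.

End LocalCoordinates.

(** Local isometry of two cosets with the denominator c cleared: [U] is its matrix in the bases of
    the two lattices, and the condition on the shifts becomes a congruence modulo c Z_p. *)
Definition loc_equiv p (pr : prime p) n (c : nat) (A : 'M[int]_n) (z : 'rV[int]_n)
    (A' : 'M[int]_n) (z' : 'rV[int]_n) : Prop :=
  exists U : 'M[padic_int pr]_n, [/\ U \in unitmx,
    U *m map_mx intr A' *m U^T = map_mx intr A &
    exists y, map_mx intr z *m U = map_mx intr z' + c%:R *: y].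

Lemma map_frac_inj p (pr : prime p) m n :
  injective (fun A : 'M[padic_int pr]_(m, n) => map_mx (@tofrac _) A).
Proof.
move=> A B /matrixP H; apply/matrixP => a b.
by have := H a b; rewrite !mxE => /fracp_inj.
Qed.

Definition shifted n (E : 'M[rat]_n) c (z : 'rV[int]_n) : set 'rV[rat]_n :=
  translate (zspan E) (c%:R^-1 *: (map_mx intr z *m E)).

Section GenusCoordinates.
Variables (n : nat) (G E : 'M[rat]_n) (A : 'M[int]_n) (c : nat) (z : 'rV[int]_n).
Hypotheses (EU : E \in unitmx) (EA : E *m sym_part G *m E^T = map_mx intr A).
Hypothesis c0 : (0 < c)%N.

(** At every p the local isometry transports the integral data of L + u/c, so the Gram matrix of K'
    and c times the coordinates of w' are integral at p; being rational, they are integers. *)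
Lemma genus_coord X :
  genus G (zspan E) (c%:R^-1 *: (map_mx intr z *m E)) X <->
  exists E' A' z', [/\ E' \in unitmx, E' *m sym_part G *m E'^T = map_mx intr A',
    X = shifted E' c z' &
    forall p (pr : prime p), loc_equiv pr c A z A' z'].
Proof.
have cQ : c%:R != 0 :> rat by rewrite pnatr_eq0 -lt0n.
split.
  move=> [_ [w' [[E' E'U ->] XE H]]].
  pose t' := w' *m invmx E'.
  have w'E : w' = t' *m E' by rewrite mulmxKV.
  have {}H p (pr : prime p) :
    exists (U : 'M[padic_int pr]_n) y, [/\ U \in unitmx,
     map_mx (@tofrac _) U *m map_mx (ratp pr) (E' *m sym_part G *m E'^T) *m (map_mx (@tofrac _) U)^T
       = map_mx (ratp pr) (E *m sym_part G *m E^T) &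
     map_mx (ratp pr) (c%:R^-1 *: map_mx intr z) *m map_mx (@tofrac _) U =
       map_mx (ratp pr) t' + map_mx (@tofrac _) y].
    by apply/local_isometryP => //; rewrite -w'E -scalemxAl; exact: H.
  have [A' A'E] : exists A', E' *m sym_part G *m E'^T = map_mx intr A'.
    apply: rat_mx_int_local => p pr; have [U [y [UU UA _]]] := H p pr.
    exists (invmx U *m map_mx intr A *m (invmx U)^T).
    have UA' : map_mx (@tofrac _) U *m map_mx (ratp pr) (E' *m sym_part G *m E'^T)
        *m (map_mx (@tofrac _) U)^T = map_mx (@tofrac _) (map_mx intr A).
      by rewrite -map_ratp_int -EA; exact: UA.
    exact: conj_unit_int UU UA'.
  have [z' z'E] : exists z', c%:R *: t' = map_mx intr z'.
    apply: rat_mx_int_local => p pr; have [U [y [UU _ yE]]] := H p pr.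
    exists (map_mx intr z *m U - c%:R *: y).
    rewrite map_mxB map_mxM map_mxZ rmorph_nat -map_ratp_int.
    rewrite map_mxZ fmorphV rmorph_nat in yE.
    rewrite ((scaled_coordP _ _ _ _ (padic_natr_neq0 pr c0)).1 yE).
    by rewrite [X in _ - X]map_mxZ rmorph_nat addrK.
  exists E', A', z'; split=> //.
    by rewrite XE /shifted -z'E -scalemxAl scalerA mulVf // scale1r mulmxKV.
  move=> p pr; have [U [y [UU UA yE]]] := H p pr; exists U; split=> //.
    apply: map_frac_inj; rewrite !map_mxM -!map_ratp_int -EA -UA A'E.
    by rewrite map_trmx.
  exists y; apply: map_frac_inj; rewrite map_mxM map_mxD -!map_ratp_int -z'E.
  rewrite map_mxZ fmorphV rmorph_nat in yE.
  rewrite ((scaled_coordP _ _ _ _ (padic_natr_neq0 pr c0)).1 yE).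
  by rewrite !map_mxZ !rmorph_nat.
move=> [E' [A' [z' [E'U E'A XE H]]]].
exists (zspan E'), (c%:R^-1 *: (map_mx intr z' *m E')); split=> //.
  by exists E'.
move=> p pr; rewrite !scalemxAl; apply/local_isometryP => //.
have [U [UU UA [y yE]]] := H p pr; exists U, y; split=> //.
  by rewrite EA E'A !map_ratp_int -UA !map_mxM map_trmx.
rewrite !map_mxZ !fmorphV !rmorph_nat.
apply: (scaled_coordP _ _ _ _ (padic_natr_neq0 pr c0)).2.
rewrite !map_ratp_int -map_mxM yE map_mxD map_mxZ rmorph_nat.
by rewrite scalerA mulfV ?scale1r // padic_natr_neq0.
Qed.

End GenusCoordinates.

(** * Hermite reduction *)

Definition int_form n (S : 'M[rat]_n) (x : 'rV[int]_n) : rat :=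
  (map_mx intr x *m S *m (map_mx intr x)^T) 0 0.

Lemma int_form_conj n (S : 'M[rat]_n) (T : 'M[int]_n) x :
  int_form (map_mx intr T *m S *m (map_mx intr T)^T) x = int_form S (x *m T).
Proof. by rewrite /int_form map_mxM trmx_mul !mulmxA. Qed.

Lemma int_formZ n (S : 'M[rat]_n) (d : int) x :
  int_form S (d *: x) = d%:~R ^+ 2 * int_form S x.
Proof.
rewrite /int_form map_mxZ linearZ /= -scalemxAr -!scalemxAl scalerA.
by rewrite mxE expr2.
Qed.

Lemma round_int (x : rat) : exists t : int, `|t%:~R + x| <= 2^-1.
Proof.
exists (- Num.floor (x + 2^-1)); have := floor_itv (x + 2^-1).
rewrite rmorphN /= rmorphD /= => /andP[h1 h2].
rewrite ler_norml; apply/andP; split; lra.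
Qed.

(* An approximate minimum is enough below, so the values of the form need not be
   discrete. *)
Lemma approx_min n (S : 'M[rat]_n) (m : rat) (v : 'rV[int]_n) : 0 < m ->
  (forall x, x != 0 -> m <= int_form S x) -> v != 0 ->
  exists2 v', v' != 0 & forall x, x != 0 -> 9%:R / 10%:R * int_form S v' <= int_form S x.
Proof.
move=> m0 Sm v0.
have [k vk] : exists k : nat, int_form S v <= m * (10%:R / 9%:R) ^+ k.
  pose K := (9 * (Num.truncn (int_form S v / m)).+1)%N; exists K.
  have B : 1 + K%:R / 9%:R <= (10%:R / 9%:R : rat) ^+ K.
    elim: K => [|K IH]; first by rewrite expr0 mul0r addr0.
    rewrite exprS -natr1; have K0 : 0 <= K%:R :> rat by rewrite ler0n.
    have h : 0 <= 10%:R / 9%:R :> rat by [].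
    have := ler_wpM2l h IH; lra.
  have h : int_form S v / m <= 1 + K%:R / 9%:R.
    have := truncnS_gt (int_form S v / m).
    by rewrite /K natrM mulrAC mulfV // mul1r => /ltW/le_trans; apply; rewrite lerDr.
  by rewrite mulrC -ler_pdivrMr //; exact: le_trans h B.
elim: k v v0 vk => [|k IH] v v0 vk.
  exists v; [exact: v0|move=> x x0]; rewrite expr0 mulr1 in vk.
  have := Sm _ x0; have := Sm _ v0; lra.
have [[x x0 xv]|H] := pselect (exists2 x, x != 0 & int_form S x < 9%:R / 10%:R * int_form S v).
  by apply: (IH x x0); move: vk; rewrite exprS; lra.
exists v; [exact: v0|move=> x x0].
rewrite leNgt; apply/negP => xv; apply: H.
by exists x.
Qed.

(** The Smith normal form of a single row: up to an integer factor, v is the first vector of a basis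
    of Z^(n+1). *)
Lemma primitive_row n (v : 'rV[int]_n.+1) : v != 0 ->
  exists (R : 'M[int]_n.+1) (d : int), [/\ R \in unitmx, d != 0 & v = d *: row 0 R].
Proof.
move=> v0; have [L LU [R RU [d _ vE]]] := int_Smith_normal_form v.
exists R, (L 0 0 * d`_0).
have E : v = (L 0 0 * d`_0) *: row 0 R.
  apply/rowP => k; rewrite vE -mulmxA !mxE big_ord1 !mxE -mulrA; congr (_ * _).
  rewrite big_ord_recl !mxE /= mulr1n big1 ?addr0 // => i _.
  by rewrite !mxE /= mulr0n mul0r.
split=> //; apply: contraNneq v0 => d0.
by rewrite E d0 scale0r.
Qed.

Lemma det_int_unit n (T : 'M[int]_n) : T \in unitmx -> (\det T) ^+ 2 = 1.
Proof.
move=> TU; have := congr1 (fun M => `|\det M|%N) (mulmxV TU).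
rewrite /= det_mulmx det1 abszM => /eqP; rewrite muln_eq1 => /andP[/eqP + _].
by case: (\det T) => [[|[|k]]|[|k]].
Qed.

Lemma row_unit_neq0 n (T : 'M[int]_n) i : T \in unitmx -> row i T != 0.
Proof.
move=> TU; apply/eqP; rewrite rowE => h.
have := mulmxK TU (delta_mx 0 i : 'rV_n); rewrite h mul0mx => /rowP/(_ i).
by rewrite !mxE !eqxx.
Qed.

Lemma conj_entry (F : fieldType) n (X S : 'M[F]_n) i k :
  (X *m S *m X^T) i k = (row i X *m S *m (row k X)^T) 0 0.
Proof. by rewrite -(delta_form (X *m S *m X^T) i k) !rowE trmx_mul !mulmxA. Qed.

Lemma det_conj_int n (S : 'M[rat]_n) (T : 'M[int]_n) : T \in unitmx ->
  \det (map_mx intr T *m S *m (map_mx intr T)^T) = \det S.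
Proof.
move=> TU; rewrite !det_mulmx det_tr det_map_mx mulrAC -expr2.
by rewrite -rmorphXn /= det_int_unit // mul1r.
Qed.

(** The Schur complement [S2] is the Gram matrix of the remaining basis vectors projected
    orthogonally to the first one. *)
Lemma complete_square n (S : 'M[rat]_(1 + n)) (a := S 0 0)
    (r := ursubmx S) (S2 := drsubmx S - a^-1 *: (r^T *m r)) :
  S^T = S -> a != 0 ->
  S = block_mx 1%:M 0 (a^-1 *: r^T) 1%:M *m block_mx a%:M 0 0 S2
        *m (block_mx 1%:M 0 (a^-1 *: r^T) 1%:M)^T.
Proof.
move=> Ss a0; rewrite tr_block_mx !mulmx_block.
rewrite !trmx1 !trmx0 !(mul1mx, mul0mx, mulmx0, mulmx1, addr0, add0r).
rewrite linearZ /= trmxK -!scalemxAr mul_scalar_mx mul_mx_scalar.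
rewrite !scalerA !(mulfV a0, mulVf a0) !scale1r.
rewrite -[LHS]submxK; congr block_mx => //.
- apply/matrixP => i k; rewrite !ord1 !mxE eqxx mulr1n.
  by congr (fun_of_matrix S _ _); apply: val_inj.
- by rewrite -[in LHS]Ss trmx_ursub.
- by rewrite /S2 addrC subrK.
Qed.

Lemma complete_square_det n (S : 'M[rat]_(1 + n)) (a := S 0 0)
    (r := ursubmx S) (S2 := drsubmx S - a^-1 *: (r^T *m r)) :
  S^T = S -> a != 0 -> \det S = a * \det S2.
Proof.
move=> Ss a0; rewrite {1}(complete_square Ss a0) !det_mulmx det_tr.
by rewrite !det_lblock !det1 det_scalar1 !mulr1 !mul1r.
Qed.

Lemma square_form n (a : rat) (S2 : 'M[rat]_n) (t : 'M[rat]_1) (y : 'rV[rat]_n) :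
  (row_mx t y *m block_mx a%:M 0 0 S2 *m (row_mx t y)^T) 0 0
   = a * t 0 0 ^+ 2 + (y *m S2 *m y^T) 0 0.
Proof.
rewrite mul_row_block !mulmx0 addr0 add0r tr_row_mx mul_row_col.
rewrite mul_mx_scalar mxE; congr (_ + _).
by rewrite -scalemxAl mxE mxE big_ord1 mxE expr2.
Qed.

(** A nearly minimal vector is made the first basis vector, the projection orthogonal to it is
    reduced by induction, and its basis is lifted back with small components along the first vector.
    The projected form keeps a positive lower bound, and its determinant is that of S divided by a
    >= m. *)
Lemma hermite_reduction n (m D : rat) : 0 < m -> exists B : rat,
  forall S : 'M[rat]_n, S^T = S -> (forall x, x != 0 -> m <= int_form S x) ->
  \det S <= D ->
  exists2 T : 'M[int]_n, T \in unitmx &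
    forall i j, `|(map_mx intr T *m S *m (map_mx intr T)^T) i j| <= B.
Proof.
elim: n m D => [|n IH] m D m0.
  by exists 0 => S _ _ _; exists 1%:M => [|[]//]; rewrite unitmx1.
(* 13/20 = 9/10 - 1/4: the near-minimality factor minus the square of the largest rounding error
   1/2. *)
have m10 : 0 < 13%:R / 20%:R * m by rewrite mulr_gt0.
have [b Hb] := IH (13%:R / 20%:R * m) (`|D| / m) m10.
exists (3%:R * `|b| + `|D|) => S Ss Sm SD.
have e0 : (delta_mx 0 0 : 'rV[int]_n.+1) != 0.
  by apply/eqP => /rowP/(_ 0); rewrite !mxE.
have [v v0 vmin] := approx_min m0 Sm e0.
have [R [d [RU d0 vE]]] := primitive_row v0.
pose S1 : 'M[rat]_(1 + n) := map_mx intr R *m S *m (map_mx intr R)^T.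
pose a := S1 0 0; pose r := ursubmx S1.
pose S2 := drsubmx S1 - a^-1 *: (r^T *m r).
have S1s : S1^T = S1 by rewrite /S1 !trmx_mul trmxK Ss mulmxA.
have rowR0 := row_unit_neq0 0 RU.
have aE : a = int_form S (row 0 R) by rewrite /a /S1 conj_entry /int_form map_row.
have am : m <= a by rewrite aE; exact: Sm.
have a0 : 0 < a by exact: lt_le_trans am.
have amin x : x != 0 -> 9%:R / 10%:R * a <= int_form S1 x.
  move=> x0; rewrite int_form_conj.
  have xR : x *m R != 0.
    by apply: contraNneq x0 => xR; rewrite -(mulmxK RU x) xR mul0mx.
  apply: le_trans (vmin _ xR); rewrite ler_pM2l // vE int_formZ -aE.
  have d1 : 1 <= (d%:~R : rat) ^+ 2.
    rewrite -rmorphXn /= -[1]/(1%:~R) ler_int.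
    by rewrite -gtz0_ge1 exprn_even_gt0.
  by rewrite -[X in X <= _]mul1r ler_wpM2r // ltW.
have a0' : a != 0 by rewrite gt_eqF.
have S1E := complete_square S1s a0'; rewrite -/a -/r -/S2 in S1E.
have S2det : \det S2 = \det S / a.
  have <- : \det S1 = \det S := det_conj_int S RU.
  by rewrite (complete_square_det S1s a0') mulrC mulKf.
have S2s : S2^T = S2.
  rewrite /S2 linearB /= linearZ /= trmx_mul trmxK; congr (_ - _).
  by rewrite trmx_drsub S1s.
have S2min y : y != 0 -> 13%:R / 20%:R * a <= int_form S2 y.
  move=> y0; pose yq := map_mx intr y : 'rV[rat]_n.
  have [t tE] := round_int ((yq *m (a^-1 *: r^T)) 0 0).
  have x0 : (row_mx t%:M y : 'rV[int]_(1 + n)) != 0.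
    by apply: contraNneq y0; rewrite -[0]row_mx0 => /eq_row_mx[_ ->].
  have := amin _ x0; rewrite /int_form map_row_mx S1E.
  rewrite !mulmxA mul_row_block -!mulmxA -trmx_mul mul_row_block.
  rewrite !mulmxA !mulmx1 !mulmx0 add0r square_form -/(int_form S2 y).
  rewrite map_scalar_mx mxE [t%:~R%:M 0 0]mxE /= mulr1n.
  set w := t%:~R + _ in tE *.
  have w4 : w ^+ 2 <= 4%:R^-1.
    rewrite -real_normK ?num_real //; have w0 := normr_ge0 w.
    by have := ler_pM w0 w0 tE tE; rewrite -expr2; lra.
  by have := ler_wpM2l (ltW a0) w4; rewrite /int_form; lra.
have S2m y : y != 0 -> 13%:R / 20%:R * m <= int_form S2 y.
  by move=> y0; apply: le_trans (S2min _ y0); rewrite ler_pM2l.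
have S2D : \det S2 <= `|D| / m.
  rewrite S2det; apply: (@le_trans _ _ (`|D| / a)).
    by rewrite ler_pM2r ?invr_gt0 //; exact: le_trans SD (ler_norm _).
  by rewrite ler_wpM2l // lef_pV2.
have [T TU TB] := Hb _ S2s S2m S2D.
pose Tq := map_mx intr T : 'M[rat]_n.
(* Adding multiples of the first basis vector brings the component of each lifted vector along it
   down to at most 1/2 in absolute value. *)
have /choice[k kE] i := round_int ((Tq *m (a^-1 *: r^T)) i 0).
pose kc := \col_i k i : 'cV[int]_n.
pose T2 : 'M[int]_(1 + n) := block_mx 1%:M 0 kc T.
have T2U : T2 \in unitmx by rewrite unitmxE det_lblock det1 mul1r -unitmxE.
exists (T2 *m R); first by rewrite unitmx_mul; apply/andP; split.
pose g := map_mx intr kc + Tq *m (a^-1 *: r^T).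
have gE i : `|g i 0| <= 2^-1 by rewrite /g mxE [(map_mx _ kc) _ _]mxE [kc _ _]mxE.
(* The entry a is controlled by the smaller form: a diagonal entry of the reduced [S2] is at least
   13/20 a and at most b. If n = 0 there is no such entry, and a is the determinant itself. *)
have a2 : a <= 2%:R * `|b| + `|D|.
  have [n0|n0] := posnP n.
    have d1 (M : 'M[rat]_n) : \det M = 1.
      by move: M; rewrite n0 => M; rewrite det_mx00.
    have aD : a = \det S.
      by apply: (mulIf (invr_neq0 a0')); rewrite -S2det d1 mulfV.
    rewrite aD; have := ler_norm D; have := normr_ge0 b; lra.
  have := TB (Ordinal n0) (Ordinal n0); rewrite conj_entry -map_row.
  have := S2min _ (row_unit_neq0 (Ordinal n0) TU); rewrite /int_form => h1 h2.
  have := ler_norm b; have := normr_ge0 D; have := ler_norm (int_form S2 (row (Ordinal n0) T)).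
  rewrite /int_form; lra.
have T2P : map_mx intr T2 *m block_mx 1%:M 0 (a^-1 *: r^T) 1%:M =
    block_mx 1%:M 0 g Tq :> 'M[rat]_(1 + n).
  rewrite map_block_mx !map_mx0 map_mx1 mulmx_block.
  by rewrite !(mul1mx, mul0mx, mulmx0, mulmx1, addr0, add0r).
have TE : map_mx intr (T2 *m R) *m S *m (map_mx intr (T2 *m R))^T =
   block_mx a%:M (a *: g^T) (a *: g) (a *: (g *m g^T) + Tq *m S2 *m Tq^T).
  have -> : map_mx intr (T2 *m R) *m S *m (map_mx intr (T2 *m R))^T =
      map_mx intr T2 *m S1 *m (map_mx intr T2)^T.
    by rewrite map_mxM trmx_mul !mulmxA.
  rewrite S1E !mulmxA T2P -!mulmxA -trmx_mul T2P !mulmxA.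
  rewrite tr_block_mx !mulmx_block.
  rewrite !trmx1 !trmx0 !(mul1mx, mul0mx, mulmx0, mulmx1, addr0, add0r).
  by rewrite mul_scalar_mx mul_mx_scalar -scalemxAl.
have b0 := normr_ge0 b; have D0 := normr_ge0 D.
have half x : `|x| <= 2^-1 -> `|a * x| <= 3%:R * `|b| + `|D|.
  move=> x2; rewrite normrM gtr0_norm //.
  by have := ler_wpM2l (ltW a0) x2; lra.
suff bound (i l : 'I_(1 + n)) : `|(block_mx a%:M (a *: g^T) (a *: g)
    (a *: (g *m g^T) + Tq *m S2 *m Tq^T) : 'M[rat]_(1 + n)) i l| <= 3%:R * `|b| + `|D|.
  by move=> i l; rewrite TE; exact: bound.
rewrite -(splitK i) -(splitK l).
case: (fintype.split i) => i'; case: (fintype.split l) => k' /=.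
- rewrite block_mxEul !ord1 mxE eqxx mulr1n gtr0_norm //; lra.
- by rewrite block_mxEur mxE [g^T _ _]mxE ord1; apply: half; exact: gE.
- by rewrite block_mxEdl mxE ord1; apply: half; exact: gE.
have ggE : (a *: (g *m g^T)) i' k' = a * (g i' 0 * g k' 0).
  by rewrite mxE mxE big_ord1 [g^T _ _]mxE.
rewrite block_mxEdr mxE ggE.
apply: (le_trans (ler_normD _ _)); have := TB i' k'; rewrite -/Tq => h.
rewrite !normrM gtr0_norm //.
have gg : `|g i' 0| * `|g k' 0| <= 4%:R^-1.
  have := ler_pM (normr_ge0 _) (normr_ge0 _) (gE i') (gE k').
  by have -> : 2^-1 * 2^-1 = 4%:R^-1 :> rat by [].
have := ler_wpM2l (ltW a0) gg; have := ler_norm b; lra.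
Qed.

(** * Finiteness of classes and automorphism groups *)

Section IsometryClasses.
Variables (n : nat) (G : 'M[rat]_n).
Local Notation iso := (isometries G).
Implicit Types X Y Z : set 'rV[rat]_n.

Lemma isometries1 : iso 1%:M.
Proof. by split=> [|v]; rewrite ?unitmx1 ?mulmx1. Qed.

Lemma isometriesM s t : iso s -> iso t -> iso (s *m t).
Proof.
move=> [sU sq] [tU tq]; split=> [|v]; first by rewrite unitmx_mul sU.
by rewrite mulmxA tq sq.
Qed.

Lemma isometriesV s : iso s -> iso (invmx s).
Proof.
move=> [sU sq]; split=> [|v]; first by rewrite unitmx_inv.
by rewrite -[in RHS](mulmxKV sU v) sq.
Qed.

Lemma carries1 X : carries 1%:M X X.
Proof.
rewrite /carries; apply/seteqP; split=> v /=; first by move=> [x Xx <-]; rewrite mulmx1.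
by move=> Xv; exists v; rewrite ?mulmx1.
Qed.

Lemma carriesM s t X Y Z : carries s X Y -> carries t Y Z -> carries (s *m t) X Z.
Proof.
move=> <- <-; apply/seteqP; split=> v /=.
  by move=> [x Xx <-]; exists (x *m s); [exists x|rewrite mulmxA].
by move=> [_ [x Xx <-] <-]; exists x; rewrite ?mulmxA.
Qed.

Lemma carriesV s X Y : s \in unitmx -> carries s X Y -> carries (invmx s) Y X.
Proof.
move=> sU <-; apply/seteqP; split=> v /=.
  by move=> [_ [x Xx <-] <-]; rewrite mulmxK.
by move=> Xv; exists (v *m s); [exists v|rewrite mulmxK].
Qed.

Lemma class_refl X : class G X X.
Proof. by exists 1%:M; [exact: isometries1|exact: carries1]. Qed.

Lemma class_sym X Y : class G X Y -> class G Y X.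
Proof.
move=> [s sI sC]; exists (invmx s); first exact: isometriesV.
by apply: carriesV sC; case: sI.
Qed.

Lemma class_trans Y X Z : class G X Y -> class G Y Z -> class G X Z.
Proof.
move=> [s sI sC] [t tI tC]; exists (s *m t); first exact: isometriesM.
exact: carriesM sC tC.
Qed.

Lemma class_repP X : class G X (class_rep G X).
Proof. by rewrite /class_rep; apply: (@getPex _ (class G X)); exists X; exact: class_refl. Qed.

Lemma class_rep_eqP X Y : class_rep G X = class_rep G Y <-> class G X Y.
Proof.
split=> [E|XY].
  by apply: class_trans (class_repP X) _; rewrite E; apply/class_sym/class_repP.
rewrite /class_rep; congr get; apply/seteqP; split=> Z h.
  exact: class_trans (class_sym XY) h.
exact: class_trans XY h.
Qed.

End IsometryClasses.

(** Codes form a relation and not a function because reduced coordinates are not unique; choosing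
    one value of f per code covers the image. *)
Lemma finite_of_code (U V : Type) (T : finType) (A : set U) (f : U -> V)
    (code : U -> T -> Prop) :
  (forall x, A x -> exists t, code x t) ->
  (forall x y t, A x -> A y -> code x t -> code y t -> f x = f y) ->
  finite_set (f @` A).
Proof.
move=> h1 h2; have [->|/set0P[x0 Ax0]] := eqVneq A set0; first by rewrite image_set0.
have h t : exists v, forall x, A x -> code x t -> v = f x.
  have [[x [Ax xt]]|N] := pselect (exists x, A x /\ code x t).
    by exists (f x) => y Ay yt; exact: h2 xt yt.
  by exists (f x0) => y Ay yt; case: N; exists y.
have [g gP] := choice h.
apply: (@sub_finite_set _ _ (g @` [set: T])).
  by move=> _ [x Ax <-]; have [t xt] := h1 _ Ax; exists t => //; exact: gP.
exact: finite_image.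
Qed.

(** * Changes of basis for lattices and their cosets *)

Section Lattices.
Variable n : nat.
Implicit Types (E : 'M[rat]_n).

Lemma zspan_unimodular E (T : 'M[int]_n) : T \in unitmx ->
  zspan (map_mx intr T *m E) = zspan E.
Proof.
move=> TU; apply/seteqP; split=> v /= [z _ <-].
  by exists (z *m T) => //; rewrite map_mxM mulmxA.
by exists (z *m invmx T) => //; rewrite mulmxA -map_mxM mulmxKV.
Qed.

Lemma translate_zspan E (y : 'rV[int]_n) w :
  translate (zspan E) (map_mx intr y *m E + w) = translate (zspan E) w.
Proof.
apply/seteqP; split=> v /= [_ [z _ <-] <-].
  exists (map_mx intr (z + y) *m E); first by exists (z + y).
  by rewrite map_mxD mulmxDl addrA.
exists (map_mx intr (z - y) *m E); first by exists (z - y).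
by rewrite map_mxB mulmxBl addrA subrK.
Qed.

Lemma shifted_change E (T : 'M[int]_n) c (z z' y : 'rV[int]_n) :
  (0 < c)%N -> T \in unitmx -> z = z' *m T + c%:Z *: y ->
  shifted E c z = shifted (map_mx intr T *m E) c z'.
Proof.
move=> c0 TU ->; rewrite /shifted zspan_unimodular // mulmxA -map_mxM map_mxD.
rewrite map_mxZ mulmxDl scalerDr -scalemxAl scalerA mulVf ?pnatr_eq0 -?lt0n //.
by rewrite scale1r addrC translate_zspan.
Qed.

Lemma zspan_shift_sub E c z v w : shifted E c z v -> shifted E c z w ->
  zspan E (v - w).
Proof.
move=> [_ [x _ <-] <-] [_ [y _ <-] <-]; exists (x - y) => //.
by rewrite map_mxB mulmxBl opprD addrACA subrr addr0.
Qed.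

Lemma shifted_base E c z : shifted E c z (c%:R^-1 *: (map_mx intr z *m E)).
Proof. by exists 0; [exists 0 => //; rewrite map_mx0 mul0mx|rewrite add0r]. Qed.

Lemma class_same_gram G E1 E2 c z : E1 \in unitmx -> E2 \in unitmx ->
  E1 *m sym_part G *m E1^T = E2 *m sym_part G *m E2^T ->
  class G (shifted E1 c z) (shifted E2 c z).
Proof.
move=> E1U E2U gram; have [W E1s WU] : exists2 W, E1 *m W = E2 & W \in unitmx.
  by exists (invmx E1 *m E2); rewrite ?mulKVmx // unitmx_mul unitmx_inv E1U.
exists W.
  apply/isometriesP => //; split=> //.
  apply: (can_inj (mulKmx E1U)); apply: (can_inj (mulmxK (_ : E1^T \in unitmx))).
    by rewrite unitmx_tr.
  by rewrite gram -!mulmxA -trmx_mul E1s !mulmxA E1s.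
apply/seteqP; split=> v /=.
  move=> [_ [_ [x _ <-] <-] <-]; exists (map_mx intr x *m E2); first by exists x.
  by rewrite mulmxDl -!scalemxAl -!mulmxA E1s.
move=> [_ [x _ <-] <-]; exists (map_mx intr x *m E1 + c%:R^-1 *: (map_mx intr z *m E1)).
  by exists (map_mx intr x *m E1) => //; exists x.
by rewrite mulmxDl -!scalemxAl -!mulmxA E1s.
Qed.

(** A lattice is the set of differences of elements of any of its cosets, so an isometry between
    cosets is one between their lattices. *)
Lemma class_zspan G E1 E2 c z1 z2 s : isometries G s ->
  carries s (shifted E1 c z1) (shifted E2 c z2) -> carries s (zspan E1) (zspan E2).
Proof.
have half (X1 X2 : 'M[rat]_n) (d1 d2 : 'rV[int]_n) t : carries t (shifted X1 c d1) (shifted X2 c d2) ->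
   forall v, zspan X1 v -> zspan X2 (v *m t).
  move=> tC v v1; set w := c%:R^-1 *: (map_mx intr d1 *m X1).
  have h : shifted X2 c d2 (w *m t).
    by rewrite -tC; exists w => //; exact: shifted_base.
  have h' : shifted X2 c d2 ((v + w) *m t) by rewrite -tC; exists (v + w) => //; exists v.
  by have := zspan_shift_sub h' h; rewrite mulmxDl addrK.
move=> [sU _] sC; apply/seteqP; split=> v.
  by move=> [x x1 <-]; exact: half sC _ x1.
move=> v2; exists (v *m invmx s); last by rewrite mulmxKV.
exact: half (carriesV sU sC) _ v2.
Qed.

Lemma mul_mx_bound (X Y : 'M[rat]_n) (b : rat) : exists B : rat,
  forall R : 'M[rat]_n, (forall i j, `|R i j| <= b) -> forall i j, `|(X *m R *m Y) i j| <= B.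
Proof.
pose F i j := \sum_k \sum_l `|X i k| * b * `|Y l j|.
exists (\sum_i \sum_j F i j) => R Rb i j.
have b0 : 0 <= b by apply: le_trans (normr_ge0 _) (Rb i j).
have F0 i' j' : 0 <= F i' j'.
  by do 2 (apply: sumr_ge0 => ? _); rewrite !mulr_ge0.
have Fi : \sum_j' F i j' <= \sum_i \sum_j F i j.
  rewrite [X in _ <= X](bigD1 i) //= lerDl; apply: sumr_ge0 => i' _.
  by apply: sumr_ge0 => ? _.
apply: le_trans Fi.
have Fj : F i j <= \sum_j' F i j'.
  by rewrite [X in _ <= X](bigD1 j) //= lerDl; apply: sumr_ge0 => i' _.
apply: le_trans Fj; rewrite /F.
rewrite exchange_big mxE; apply: (le_trans (ler_norm_sum _ _ _)); apply: ler_sum => l _.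
rewrite mxE mulr_suml; apply: (le_trans (ler_norm_sum _ _ _)); apply: ler_sum => k _.
by rewrite !normrM ler_wpM2r // ler_wpM2l.
Qed.

End Lattices.

(** Entries are shifted by half the range, so that negative integers too are coded by ordinals. *)
Lemma bounded_int_code (B : rat) : exists (N : nat), forall (m k : nat) (T : 'M[int]_(m, k)),
  (forall i j, `|(T i j)%:~R| <= B) ->
  exists M : 'M['I_N.+1]_(m, k), T = map_mx (fun i : 'I_N.+1 => i%:Z - (N./2)%:Z) M.
Proof.
pose N := (Num.truncn `|B|).+1; exists N.*2 => m k T TB.
have lt_ij i j : (`|T i j|%N < N)%N.
  rewrite -(ltr_nat rat) natr_absz intr_norm; apply: le_lt_trans (truncnS_gt _).
  exact: le_trans (TB i j) (ler_norm _).
exists (\matrix_(i, j) inord `|(T i j + N%:Z)%R|%N).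
apply/matrixP => i j; rewrite !mxE doubleK; have := lt_ij i j => h.
rewrite inordK; lia.
Qed.

Section Finiteness.
Variables (n : nat) (G E : 'M[rat]_n) (A : 'M[int]_n) (c : nat) (z : 'rV[int]_n).
Variable a : 'I_n -> nat.
Hypotheses (EU : E \in unitmx) (EA : E *m sym_part G *m E^T = map_mx intr A).
Hypotheses (a0 : forall j, (0 < a j)%N) (c0 : (0 < c)%N).
Hypothesis Aa : A = diag_mx (\row_j (a j)%:Z).

Lemma diag_form (x : 'rV[rat]_n) : (x *m map_mx intr A *m x^T) 0 0 =
  \sum_j (a j)%:R * x 0 j ^+ 2.
Proof.
rewrite Aa map_diag_mx mul_mx_diag mxE; apply: eq_bigr => j _; rewrite !mxE.
by rewrite expr2 mulrA [x 0 j * _]mulrC.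
Qed.

(** In the basis [E] the form is diagonal with positive coefficients, while on K' it takes integer
    values; a positive integer is at least 1. This is the lower bound that the reduction asks
    for. *)
Lemma gram_pos E' A' x : E' \in unitmx -> E' *m sym_part G *m E'^T = map_mx intr A' ->
  x != 0 -> 1 <= int_form (map_mx intr A') x.
Proof.
move=> E'U E'A x0; pose y := map_mx intr x *m E' *m invmx E : 'rV[rat]_n.
have q : int_form (map_mx intr A') x = \sum_j (a j)%:R * y 0 j ^+ 2.
  rewrite -diag_form -EA -E'A /int_form /y; congr (fun_of_matrix _ _ _).
  rewrite !trmx_mul !mulmxA mulmxKV //.
  by rewrite -(mulmxA _ E^T) -trmx_mul mulVmx // trmx1 mulmx1.
have qpos : 0 < int_form (map_mx intr A') x.
  have y0 : y != 0.
    apply: contraNneq x0 => y0; apply/eqP/(map_mx_inj (@intr_inj rat)).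
    rewrite map_mx0 -(mulmxK E'U (map_mx intr x)) -(mulmxKV EU (_ *m E')) -/y y0.
    by rewrite !mul0mx.
  have [j yj] : exists j, y 0 j != 0.
    apply: contrapT => H; case/eqP: y0; apply/rowP => j; rewrite [RHS]mxE.
    by apply/eqP/negP => yj; apply: H; exists j; apply/negP.
  have aj j' : 0 < (a j')%:R :> rat by rewrite ltr0n.
  rewrite q (bigD1 j) //= ltr_pwDl //; first by rewrite mulr_gt0 // exprn_even_gt0.
  by apply: sumr_ge0 => i _; rewrite mulr_ge0 ?sqr_ge0 // ltW.
have [k kE] : exists k : int, int_form (map_mx intr A') x = k%:~R.
  exists ((x *m A' *m x^T) 0 0); by rewrite /int_form map_trmx -!map_mxM mxE.
by move: qpos; rewrite kE -[1]/(1%:~R) ltr0z ler_int gtz0_ge1.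
Qed.

(** In each Q_p the quotient det A / det A' is the square of det U, which lies in Z_p; so it is a
    nonzero integer, and det A' is at most the absolute value of det A. *)
Lemma genus_det E' A' z' : E' \in unitmx -> E' *m sym_part G *m E'^T = map_mx intr A' ->
  (forall p (pr : prime p), loc_equiv pr c A z A' z') ->
  \det (map_mx intr A' : 'M[rat]_n) <= `|\det (map_mx intr A)|.
Proof.
move=> E'U E'A H.
have SU : sym_part G \in unitmx.
  have : map_mx intr A \in (unitmx : {pred 'M[rat]_n}).
    rewrite unitmxE Aa map_diag_mx det_diag unitfE; apply/prodf_neq0 => j _.
    by rewrite !mxE /= pnatr_eq0 -lt0n.
  by rewrite -EA !unitmx_mul => /andP[/andP[]].
have A'U : map_mx intr A' \in (unitmx : {pred 'M[rat]_n}).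
  by rewrite -E'A !unitmx_mul E'U SU unitmx_tr.
have AU : map_mx intr A \in (unitmx : {pred 'M[rat]_n}).
  by rewrite -EA !unitmx_mul EU SU unitmx_tr.
rewrite unitmxE unitfE in A'U; rewrite unitmxE unitfE in AU.
have [k kE] : exists k : int, \det (map_mx intr A : 'M[rat]_n) / \det (map_mx intr A' : 'M[rat]_n) = k%:~R.
  apply: rat_int_local => p pr; have [U [UU UA _]] := H p pr.
  exists (\det U ^+ 2); rewrite fmorph_div /= -!(det_map_mx (ratp pr)) !map_ratp_int.
  have dE : \det (map_mx intr A) = \det U ^+ 2 * \det (map_mx intr A' : 'M[padic_int pr]_n).
    by rewrite -UA !det_mulmx det_tr mulrAC -expr2.
  rewrite !(det_map_mx (@tofrac (padic_int pr))) dE rmorphM /= mulfK //.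
  rewrite tofrac_eq0 det_map_mx padic_intr_eq0.
  by move: A'U; rewrite det_map_mx intr_eq0.
have k0 : k != 0.
  apply/eqP => k0; move: kE; rewrite k0 => /eqP.
  by rewrite mulf_eq0 invr_eq0 (negPf AU) (negPf A'U).
have -> : \det (map_mx intr A : 'M[rat]_n) = k%:~R * \det (map_mx intr A' : 'M[rat]_n).
  by rewrite -kE mulfVK.
apply: (le_trans (ler_norm _)); rewrite normrM ler_peMl //.
by rewrite -intr_norm -[1]/(1%:~R) ler_int -gtz0_ge1 normr_gt0.
Qed.

Lemma genus_coord_bounded : exists B : rat, forall X,
  genus G (zspan E) (c%:R^-1 *: (map_mx intr z *m E)) X ->
  exists E' (A' : 'M[int]_n) (z' : 'rV['I_c]_n), [/\ E' \in unitmx,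
    E' *m sym_part G *m E'^T = map_mx intr A',
    forall i j, `|(A' i j)%:~R| <= B & X = shifted E' c (map_mx (fun i : 'I_c => (i : nat)%:Z) z')].
Proof.
have [B HB] := @hermite_reduction n 1 `|\det (map_mx intr A : 'M[rat]_n)| ltr01.
exists B => X /(genus_coord z EU EA c0)[E' [A' [z' [E'U E'A XE loc]]]].
have A's : (map_mx intr A' : 'M[rat]_n)^T = map_mx intr A'.
  by rewrite -E'A !trmx_mul trmxK sym_part_tr mulmxA.
have [T TU TB] := HB _ A's (fun x => gram_pos E'U E'A) (genus_det E'U E'A loc).
have z'c i : (`|(z' *m invmx T) 0%R i %% c|%Z < c)%N.
  rewrite -ltz_nat gez0_abs ?modz_ge0 ?eqz_nat -?lt0n // ltz_pmod //.
(* In the reduced basis the shift has coordinates z' T^-1, and the coset depends only on their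
   residues modulo c. *)
exists (map_mx intr T *m E'), (T *m A' *m T^T), (\row_i Ordinal (z'c i)); split.
- by rewrite unitmx_mul E'U andbT map_unitmx_rmorph.
- by rewrite trmx_mul !mulmxA -(mulmxA _ E') -(mulmxA _ _ E'^T) E'A !map_mxM map_trmx.
- move=> i j; by have := TB i j; rewrite map_trmx -!map_mxM mxE.
rewrite XE; apply: (@shifted_change _ _ _ _ _ _ (map_mx (fun k : int => (k %/ c)%Z) (z' *m invmx T) *m T)) => //.
rewrite scalemxAl -mulmxDl -[LHS](mulmxKV TU); congr (_ *m _).
move: (z' *m invmx T) z'c => v z'c; apply/rowP => i; rewrite !mxE /=.
rewrite gez0_abs ?modz_ge0 ?eqz_nat -?lt0n // addrC mulrC.
exact: divz_eq.
Qed.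

Lemma finite_classes :
  finite_set (class_rep G @` genus G (zspan E) (c%:R^-1 *: (map_mx intr z *m E))).
Proof.
have [B HB] := genus_coord_bounded; have [N HN] := bounded_int_code B.
pose dec (M : 'M['I_N.+1]_n) := map_mx (fun i : 'I_N.+1 => i%:Z - (N./2)%:Z) M.
apply: (@finite_of_code _ _ ('M['I_N.+1]_n * 'rV['I_c]_n)%type _ _
  (fun X t => exists E', [/\ E' \in unitmx, E' *m sym_part G *m E'^T = map_mx intr (dec t.1) &
     X = shifted E' c (map_mx (fun i : 'I_c => (i : nat)%:Z) t.2)])).
  move=> X /HB[E' [A' [z' [E'U E'A A'B XE]]]]; have [M A'M] := HN _ _ _ A'B.
  by exists (M, z'), E'; rewrite /dec -A'M.
move=> X Y t _ _ [E1 [E1U E1A ->]] [E2 [E2U E2A ->]].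
by apply/class_rep_eqP/class_same_gram => //; rewrite E1A.
Qed.

(** In the basis [E] an isometry has a matrix R with sum_j a_j R_ij^2 = a_i, so its entries are
    bounded; in the basis [E'] of the lattice its matrix is integral. A bounded integer matrix has
    finitely many values. *)
Lemma finite_autos (E' : 'M[rat]_n) (z' : 'rV[int]_n) : E' \in unitmx ->
  finite_set (autos G (shifted E' c z')).
Proof.
move=> E'U; have [B HB] := mul_mx_bound (E' *m invmx E) (E *m invmx E') (\sum_i (a i)%:R).
have [N HN] := bounded_int_code B.
rewrite -[X in finite_set X]image_id.
apply: (@finite_of_code _ _ 'M['I_N.+1]_n _ _ (fun s M =>
   E' *m s *m invmx E' = map_mx intr (map_mx (fun i : 'I_N.+1 => i%:Z - (N./2)%:Z) M))); last first.
  move=> s t M _ _ <-.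
  by move/(can_inj (mulmxKV E'U))/(can_inj (mulKmx E'U)).
move=> s [sI sC]; have /isometriesP[//|sU sG] := sI.
have sK := class_zspan sI sC.
have [T [y [TE _]]] : exists (U : 'M[int]_n) (y : 'rV[int]_n),
   E' *m s = map_mx intr U *m E' /\ 0 *m s = map_mx intr y *m E' + 0.
  apply: lattice_map_coord => x; rewrite addr0.
  have : zspan E' (map_mx intr x *m E' *m s).
    by rewrite -sK; exists (map_mx intr x *m E') => //; exists x.
  by move=> [x' _ <-]; exists x'; rewrite addr0.
have Ts : E' *m s *m invmx E' = map_mx intr T by rewrite TE mulmxK.
pose R := E *m s *m invmx E.
have RA : R *m map_mx intr A *m R^T = map_mx intr A.
  rewrite -EA /R !trmx_mul !mulmxA mulmxKV //.
  rewrite -(mulmxA _ E^T) -trmx_mul mulVmx // trmx1 mulmx1.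
  by rewrite -(mulmxA _ s) -(mulmxA _ _ s^T) sG.
have aQ i : 0 < (a i)%:R :> rat by rewrite ltr0n.
have Rb i j : `|R i j| <= \sum_i (a i)%:R.
  have : (R *m map_mx intr A *m R^T) i i = (a i)%:R.
    by rewrite RA Aa !mxE eqxx mulr1n.
  rewrite conj_entry diag_form (bigD1 j) //= mxE => h.
  have h1 : `|R i j| ^+ 2 <= (a i)%:R.
    rewrite real_normK ?num_real // -h.
    apply: (@le_trans _ _ ((a j)%:R * R i j ^+ 2)).
      by rewrite ler_peMl ?sqr_ge0 // ler1n.
    by rewrite lerDl sumr_ge0 // => k _; rewrite mulr_ge0 ?sqr_ge0 // ltW.
  have h2 : `|R i j| <= (a i)%:R.
    rewrite leNgt; apply/negP => h2; have : 1 <= (a i)%:R :> rat by rewrite ler1n.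
    move=> a1; have := ler_pM (ltW (aQ i)) ler01 (ltW h2) (le_trans a1 (ltW h2)).
    nra.
  by apply: (le_trans h2); rewrite (bigD1 i) //= lerDl sumr_ge0.
have [i j|M TM] := HN _ _ T; last by exists M; rewrite Ts TM.
have := HB R Rb i j.
have -> : E' *m invmx E *m R *m (E *m invmx E') = map_mx intr T.
  by rewrite -Ts /R !mulmxA !mulmxKV.
by rewrite mxE.
Qed.

End Finiteness.

(** * Cosets obtained from reflections *)

Lemma chinese_seq (s : seq nat) (e r : nat -> nat) : uniq s -> all prime s ->
  exists m, forall p, p \in s -> m = r p %[mod p ^ e p].
Proof.
elim: s => [|q s IH] /=; first by exists 0.
move=> /andP[qs us] /andP[pq ps]; have [m mP] := IH us ps.
pose Q := (\prod_(p <- s) p ^ e p)%N.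
have cop : coprime (q ^ e q) Q.
  rewrite /Q big_seq; apply: (big_ind (coprime _)) => [|x y cx cy|p ps'].
  - exact: coprimen1.
  - by rewrite coprimeMr cx.
  apply: coprimeXl; apply: coprimeXr; rewrite prime_coprime //.
  rewrite dvdn_prime2 //; last exact: (allP ps).
  by apply: contraNneq qs => ->.
exists (chinese (q ^ e q) Q (r q) m) => p; rewrite inE => /predU1P[->|ps'].
  by rewrite chinese_modl.
have pQ : (p ^ e p %| Q)%N by rewrite /Q (big_rem p) //= dvdn_mulr.
by rewrite -(modn_dvdm _ pQ) chinese_modr // (modn_dvdm _ pQ) mP.
Qed.

(** * Congruences modulo c, locally and globally *)

Section CongruencesModC.
Variable c : nat.
Hypothesis c0 : (0 < c)%N.

Lemma padic_cong p (pr : prime p) (a b : nat) : a = b %[mod p ^ logn p c] ->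
  exists y : padic_int pr, a%:R = b%:R + c%:R * y.
Proof.
move=> ab; have [m pm cE] := pfactor_coprime pr c0.
have mU := padic_natr_unit pr pm; set q := (p ^ logn p c)%N in ab cE.
exists (m%:R^-1 * ((a %/ q)%:R - (b %/ q)%:R)).
rewrite mulrA cE natrM [m%:R * _]mulrC mulrK // mulrBr.
rewrite {1}(divn_eq a q) {1}(divn_eq b q) ab !natrD !natrM ![_ * q%:R]mulrC.
by rewrite [RHS]addrC addrA subrK.
Qed.

(** At p | c only the residues modulo the p-part of c matter, and these are glued by Chinese
    remaindering; at the other primes c is a unit and the congruence is void. This lets one global
    vector replace a family of local images. *)
Lemma padic_approx_mx m n (U : forall p (pr : prime p), 'M[padic_int pr]_(m, n)) :
  exists M : 'M[int]_(m, n), forall p (pr : prime p),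
    exists Y, U p pr = map_mx intr M + c%:R *: Y.
Proof.
(* [U] takes a proof of primality, so r has the default value 0 at other p; it is evaluated only at
   prime factors of c. *)
pose r i j p := if pselect (prime p) is left pr then residue (U p pr i j) (logn p c) else 0%N.
have /choice[M MP] (ij : 'I_m * 'I_n) :=
  chinese_seq (fun p => logn p c) (r ij.1 ij.2) (primes_uniq c) (all_prime_primes c).
exists (\matrix_(i, j) (M (i, j))%:Z) => p pr.
suff /choice[Y YP] (ij : 'I_m * 'I_n) : exists y : padic_int pr,
    U p pr ij.1 ij.2 = (M ij)%:R + c%:R * y.
  by exists (\matrix_(i, j) Y (i, j)); apply/matrixP => i j; rewrite !mxE (YP (i, j)).
case: ij => i j /=.
have [pc|pc] := boolP (p \in primes c); last first.
  have cU : (c%:R : padic_int pr) \is a GRing.unit.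
    apply: padic_natr_unit; rewrite prime_coprime //.
    by move: pc; rewrite mem_primes pr c0.
  exists (c%:R^-1 * (U p pr i j - (M (i, j))%:R)).
  by rewrite mulrA mulrV // mul1r addrC subrK.
have [y ->] := padic_approx (U p pr i j) c0.
have := MP (i, j) _ pc; rewrite /= /r; case: pselect => // pr' /esym.
rewrite (bool_irrelevance pr' pr) => /(padic_cong pr)[y' ->].
by exists (y + y'); rewrite mulrDr addrA addrAC -addrA addrCA addrA.
Qed.

Lemma dvdz_local (k : int) :
  (forall p (pr : prime p), exists x : padic_int pr, k%:~R = c%:R * x) -> (c %| k)%Z.
Proof.
move=> H; have cQ : c%:R != 0 :> rat by rewrite pnatr_eq0 -lt0n.
have [t tE] : exists t : int, k%:~R / c%:R = t%:~R :> rat.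
  apply: rat_int_local => p pr; have [x xE] := H p pr; exists x.
  apply: (mulIf (padic_natr_neq0 pr c0)).
  have cE : ratp pr c%:R = c%:R by rewrite rmorph_nat.
  rewrite -[in LHS]cE -rmorphM /= mulfVK //.
  by rewrite ratp_int xE rmorphM /= rmorph_nat mulrC.
apply/dvdzP; exists t; apply: (@intr_inj rat); rewrite intrM -tE.
by rewrite mulfVK.
Qed.

End CongruencesModC.

(** * Reflections in vectors of unit norm *)

Section Reflection.
Variables (D : comUnitRingType) (n : nat) (A : 'M[D]_n) (w : 'rV[D]_n) (q : D).
Hypotheses (As : A^T = A) (qU : q \is a GRing.unit) (qE : w *m A *m w^T = q%:M).

(** The division by q = Q(w) takes place in [D]: a unit norm is what makes the reflection an
    automorphism of the lattice itself. *)
Definition reflection : 'M[D]_n := 1%:M - (2%:R / q) *: (A *m w^T *m w).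

Lemma reflectionE (x : 'rV[D]_n) :
  x *m reflection = x - (2%:R * (x *m A *m w^T) 0 0 / q) *: w.
Proof.
rewrite mulmxBr mulmx1 -scalemxAr !mulmxA; congr (_ - _).
rewrite [x *m A *m w^T]mx11_scalar mul_scalar_mx scalerA !mxE eqxx mulr1n.
by rewrite mulrAC.
Qed.

Let a : 'cV[D]_n := A *m w^T.
Let wA : w *m A = a^T. Proof. by rewrite /a trmx_mul trmxK As. Qed.

Lemma reflection_isometry : reflection *m A *m reflection^T = A.
Proof.
set k := 2%:R / q; have kq : k * k * q = 2%:R * k.
  by rewrite -mulrA {2}/k mulrVK // mulrC.
have RT : reflection^T = 1%:M - k *: (w^T *m a^T).
  by rewrite /reflection raddfB /= trmx1 [(_ *: _)^T]linearZ /= -/a trmx_mul.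
rewrite RT /reflection -/a -/k.
rewrite mulmxBr mulmx1 -!scalemxAr mulmxBl mul1mx -scalemxAl.
rewrite -(mulmxA a w A) wA mulmxBl -!scalemxAl.
have -> : A *m (w^T *m a^T) = a *m a^T by rewrite mulmxA.
have -> : a *m a^T *m (w^T *m a^T) = q *: (a *m a^T).
  by rewrite -mulmxA (mulmxA a^T) -wA qE mul_scalar_mx -scalemxAr.
move: (a *m a^T) k kq {RT} => N k kq; rewrite scalerBr.
have -> : k *: (k *: (q *: N)) = k *: N + k *: N.
  by rewrite (scalerA k q) scalerA mulrA kq mulr_natl mulr2n scalerDl.
by rewrite opprB addrK subrK.
Qed.

Lemma reflection_unit : reflection \in unitmx.
Proof.
set k := 2%:R / q; have kq : k * (k * q) = k + k by rewrite /k mulrVK // mulr_natr mulr2n.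
suff : reflection *m reflection = 1%:M by case/mulmx1_unit.
rewrite {2}/reflection -/a -/k mulmxBr mulmx1 -scalemxAr mulmxA.
have -> : reflection *m a = - a.
  rewrite /reflection -/a -/k mulmxBl mul1mx -scalemxAl -(mulmxA a).
  have -> : w *m a = q%:M by rewrite /a mulmxA.
  rewrite mul_mx_scalar scalerA /k mulrVK //.
  by rewrite scaler_nat mulr2n opprD addrA subrr sub0r.
by rewrite mulNmx scalerN opprK /reflection subrK.
Qed.

End Reflection.

(* The displacement y = w/Q(w) determines w, since Q(w)^-1 = 2 B(z, y). *)
Lemma displacement_inj (D : comUnitRingType) n (A : 'M[D]_n) (z w w' : 'rV[D]_n)
    (Q := fun x : 'rV[D]_n => (x *m A *m x^T) 0 0)
    (B := fun x : 'rV[D]_n => (z *m A *m x^T) 0 0 * 2%:R) :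
  B w = 1 -> B w' = 1 -> Q w \is a GRing.unit ->
  z - (Q w)^-1 *: w = z - (Q w')^-1 *: w' -> w = w'.
Proof.
move=> w1 w1' wU /addrI/oppr_inj h.
have lin k x : B (k *: x) = k * B x by rewrite /B linearZ /= -scalemxAr mxE mulrA.
have := congr1 B h; rewrite !lin w1 w1' !mulr1 => qq; rewrite -qq in h.
by move/(congr1 (fun x => Q w *: x)): h; rewrite !scalerA mulrV // !scale1r.
Qed.

Lemma intr_Zc_eq0 c (k : int) : (1 < c)%N -> (k%:~R == 0 :> 'Z_c) = (c %| k)%Z.
Proof.
move=> c1; have nat0 m : (m%:R == 0 :> 'Z_c) = (c %| m)%N.
  by rewrite -(inj_eq val_inj) /= val_Zp_nat.
case: k => k; first by rewrite -pmulrn nat0.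
by rewrite NegzE mulrNz oppr_eq0 -pmulrn nat0 dvdzE abszN.
Qed.

Definition lift_Zc c m n (w : 'M['Z_c]_(m, n)) : 'M[int]_(m, n) :=
  map_mx (fun k : 'Z_c => (k : nat)%:Z) w.

Lemma nat_intr_Zc c (k : 'Z_c) : ((k : nat)%:Z)%:~R = k.
Proof. by rewrite -pmulrn natr_Zp. Qed.

Lemma lift_ZcK c m n (w : 'M['Z_c]_(m, n)) : map_mx intr (lift_Zc w) = w.
Proof. by apply/matrixP => i j; rewrite !mxE -pmulrn natr_Zp. Qed.

Lemma translate0 n (K : set 'rV[rat]_n) : translate K 0 = K.
Proof.
apply/seteqP; split=> v /=; first by move=> [x Kx <-]; rewrite addr0.
by move=> Kv; exists v; rewrite ?addr0.
Qed.

Lemma map_intr_subZ (D : pzRingType) m n (x y : 'M[int]_(m, n)) (k : int) :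
  map_mx intr (x - k *: y) = map_mx intr x - k%:~R *: map_mx intr y :> 'M[D]_(m, n).
Proof. by rewrite map_mxB map_mxZ. Qed.

(** With k = c: the equations 2 B(z, w) = 1 and r = Q(w)^-1 hold only modulo c, and so the exact
    image under the reflection agrees with z - r w modulo c. *)
Lemma displacement_cong (D : comUnitRingType) n (x v : 'rV[D]_n) (b r q t t' k : D) :
  q \is a GRing.unit -> r * q = 1 + t * k -> 2%:R * b = 1 + t' * k ->
  x - (2%:R * b / q) *: v = x - r *: v + k *: ((t - t') / q *: v).
Proof.
move=> qU h1 h2; rewrite scalerA -addrA; congr (_ + _).
rewrite -scaleNr -[- (r *: v)]scaleNr -scalerDl; congr (_ *: _).
apply: (mulIr qU); rewrite h2 mulNr mulrVK // mulrDl mulNr h1 mulrA mulrVK //.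
ring.
Qed.

Lemma shifted_inj n (E : 'M[rat]_n) c (z z' : 'rV[int]_n) : E \in unitmx -> (0 < c)%N ->
  shifted E c z = shifted E c z' -> exists x : 'rV[int]_n, z - z' = c%:Z *: x.
Proof.
move=> EU c0 zz; have h := shifted_base E c z; have h' := shifted_base E c z'.
rewrite -zz in h'; have [x _ xE] := zspan_shift_sub h h'.
exists x; apply: (map_mx_inj (@intr_inj rat)); apply: (can_inj (mulmxK EU)).
rewrite map_mxZ -scalemxAl xE -scalerBr scalerA mulfV ?pnatr_eq0 -?lt0n //.
by rewrite scale1r map_mxB mulmxBl.
Qed.

Lemma map_Zc_eq c n (v v' : 'rV[int]_n) : (1 < c)%N ->
  (forall i, (c %| (v - v')%R 0%R i)%Z) -> map_mx intr v = map_mx intr v' :> 'rV['Z_c]_n.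
Proof.
move=> c1 H; apply/rowP => i; apply/eqP; rewrite !mxE -subr_eq0.
by have := H i; rewrite -intr_Zc_eq0 // !mxE rmorphB.
Qed.

(** [M] need not be invertible over Z, but it is congruent modulo c to the invertible [U], so
    multiplication by it cancels modulo c. *)
Lemma cancel_unit_cong (D : comUnitRingType) n c (v x : 'rV[int]_n) (M : 'M[int]_n)
    (U Y : 'M[D]_n) :
  U \in unitmx -> U = map_mx intr M + c%:R *: Y -> v *m M = c%:Z *: x ->
  forall i, exists t : D, (v 0 i)%:~R = c%:R * t.
Proof.
move=> UU UE vM i; pose d := map_mx intr v : 'rV[D]_n.
have dU : d *m U = c%:R *: (map_mx intr x + d *m Y).
  by rewrite UE mulmxDr -map_mxM vM map_mxZ scalerDr -scalemxAr.
exists (((map_mx intr x + d *m Y) *m invmx U) 0 i).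
have -> : (v 0 i)%:~R = d 0 i by rewrite !mxE.
by rewrite -[d in LHS](mulmxK UU) dU -scalemxAl mxE.
Qed.

Section CosetFamily.
Variables (n : nat) (G E : 'M[rat]_n) (A : 'M[int]_n) (c : nat) (z : 'rV[int]_n).
Hypotheses (EU : E \in unitmx) (EA : E *m sym_part G *m E^T = map_mx intr A).
Hypotheses (As : A^T = A) (c1 : (1 < c)%N).

Let c0 : (0 < c)%N := ltnW c1.
Local Notation "M ^Z" := (map_mx (intr : int -> 'Z_c) M) (at level 2, format "M ^Z").

(* The vectors w of (Z/c)^n along which the reflection moves z by -w/Q(w). *)
Definition unit_vectors : {set 'rV['Z_c]_n} := [set w : 'rV['Z_c]_n |
  ((z^Z *m A^Z *m w^T) 0 0 * 2%:R == 1) && ((w *m A^Z *m w^T) 0 0 \is a GRing.unit)].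

Lemma unit_vectorsP w : w \in unit_vectors ->
  (z^Z *m A^Z *m w^T) 0 0 * 2%:R = 1 /\ (w *m A^Z *m w^T) 0 0 \is a GRing.unit.
Proof. by rewrite inE => /andP[/eqP]. Qed.

(** An integer representative modulo c of the reflected vector; the same one serves all p | c. *)
Definition reflected (w : 'rV['Z_c]_n) : 'rV[int]_n :=
  z - (((w *m A^Z *m w^T) 0 0)^-1 : nat)%:Z *: lift_Zc w.

Lemma reflected_mod w : (reflected w)^Z = z^Z - ((w *m A^Z *m w^T) 0 0)^-1 *: w.
Proof.
by rewrite /reflected map_intr_subZ lift_ZcK nat_intr_Zc.
Qed.

Lemma reflected_inj w w' : w \in unit_vectors -> w' \in unit_vectors ->
  (reflected w)^Z = (reflected w')^Z -> w = w'.
Proof.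
move=> wW wW' ww'; have h := etrans (esym (reflected_mod w)) (etrans ww' (reflected_mod w')).
have [w1 wU] := unit_vectorsP wW; have [w1' _] := unit_vectorsP wW'.
exact: displacement_inj w1 w1' wU h.
Qed.

(** The integer lift of w has a norm prime to c, hence a unit of Z_p for p | c, and its reflection
    is the required local isometry. *)
Lemma reflected_local w p (pr : prime p) : w \in unit_vectors -> (p %| c)%N ->
  exists R : 'M[padic_int pr]_n, [/\ R \in unitmx,
    R *m map_mx intr A *m R^T = map_mx intr A &
    exists y, map_mx intr z *m R = map_mx intr (reflected w) + c%:R *: y].
Proof.
move=> /unit_vectorsP[w1 wU] pc.
pose v := lift_Zc w; pose q := (v *m A *m v^T) 0 0; pose b := (z *m A *m v^T) 0 0.
pose r : int := (((w *m A^Z *m w^T) 0 0)^-1 : nat)%:Z.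
have qZ : (q%:~R : 'Z_c) = (w *m A^Z *m w^T) 0 0.
  by rewrite -[in RHS](lift_ZcK w) map_trmx -!map_mxM mxE.
have bZ : (b%:~R : 'Z_c) = (z^Z *m A^Z *m w^T) 0 0.
  by rewrite -[in RHS](lift_ZcK w) map_trmx -!map_mxM mxE.
have rZ : (r%:~R : 'Z_c) = ((w *m A^Z *m w^T) 0 0)^-1 by exact: nat_intr_Zc.
have [t tE] : exists t, r * q - 1 = t * c%:Z.
  by apply/dvdzP; rewrite -intr_Zc_eq0 // rmorphB rmorphM /= rZ qZ mulVr // subrr.
have [t' t'E] : exists t, b * 2 - 1 = t * c%:Z.
  by apply/dvdzP; rewrite -intr_Zc_eq0 // rmorphB rmorphM /= bZ w1 subrr.
have qp : coprime p `|q|%N.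
  rewrite prime_coprime //; apply/negP => pq.
  have : (p%:Z %| r * q - t * c%:Z)%Z by rewrite rpredB // dvdz_mull.
  rewrite -tE opprB addrC subrK.
  by rewrite dvdz1 /= => /eqP p1; move: pr; rewrite p1.
have qU := padic_intr_unit pr qp.
have As' : (map_mx intr A : 'M[padic_int pr]_n)^T = map_mx intr A by rewrite map_trmx As.
have qE : map_mx intr v *m map_mx intr A *m (map_mx intr v)^T = (q%:~R : padic_int pr)%:M.
  by rewrite map_trmx -!map_mxM [X in map_mx _ X]mx11_scalar map_scalar_mx.
exists (reflection (map_mx intr A) (map_mx intr v) q%:~R); split.
- exact: reflection_unit.
- exact: reflection_isometry.
rewrite reflectionE // map_trmx -!map_mxM [(map_mx _ _) 0 0]mxE -/b.
rewrite /reflected -/r -/v map_mxB map_mxZ.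
exists ((t%:~R - t'%:~R) / q%:~R *: map_mx intr v).
have h1 : (r%:~R * q%:~R : padic_int pr) = 1 + t%:~R * c%:R.
  by rewrite -intrM -[r * q](subrK 1) tE rmorphD rmorphM /= addrC.
have h2 : (2%:R * b%:~R : padic_int pr) = 1 + t'%:~R * c%:R.
  rewrite -[2%:R]/((2%:Z)%:~R) -intrM mulrC -[b * 2](subrK 1) t'E rmorphD rmorphM /= addrC.
  by [].
exact: displacement_cong qU h1 h2.
Qed.

(** At p | c a reflection of L_p followed by [U p] leads from L + u/c to a coset of K. Replacing
    every [U p] by the one integer matrix [M] changes the shift only modulo c, and distinct w keep
    distinct cosets because multiplication by [M] is injective modulo c. *)
Lemma coset_family K : genus G (zspan E) 0 K ->
  exists E' (f : 'rV['Z_c]_n -> 'rV[int]_n), [/\ E' \in unitmx, K = zspan E',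
    forall w, w \in unit_vectors ->
      genus G (zspan E) (c%:R^-1 *: (map_mx intr z *m E)) (shifted E' c (f w)) &
    {in unit_vectors &, forall w w', shifted E' c (f w) = shifted E' c (f w') -> w = w'}].
Proof.
(* The unshifted lattice is the case c = 1 of the coordinate description. *)
have -> : 0 = 1%:R^-1 *: (map_mx intr 0 *m E) :> 'rV[rat]_n.
  by rewrite map_mx0 mul0mx scaler0.
move=> /(genus_coord 0 EU EA (ltn0Sn 0))[E' [A' [z' [E'U E'A KE loc]]]].
pose U p (pr : prime p) : 'M[padic_int pr]_n := projT1 (cid (loc p pr)).
have UP p (pr : prime p) : U p pr \in unitmx /\
    U p pr *m map_mx intr A' *m (U p pr)^T = map_mx intr A.
  by rewrite /U; case: (cid _) => /= V [].
have [M MP] := padic_approx_mx c0 U.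
exists E', (fun w => reflected w *m M); split; first exact: E'U.
- by rewrite KE /shifted invr1 scale1r -[_ *m _]addr0 translate_zspan translate0.
- move=> w wW; apply/(genus_coord z EU EA c0).
  exists E', A', (reflected w *m M); split; [exact: E'U|exact: E'A|by []|move=> p pr].
  have [UU UA] := UP p pr; have [Y YE] := MP p pr.
  (* At p not dividing c all vectors are congruent modulo c Z_p = Z_p, so [U p] alone suffices. *)
  have [pc|pc] := boolP (p %| c)%N; last first.
    have cU : (c%:R : padic_int pr) \is a GRing.unit.
      by apply: padic_natr_unit; rewrite prime_coprime.
    exists (U p pr); split; [exact: UU|exact: UA|].
    exists (c%:R^-1 *: (map_mx intr z *m U p pr - map_mx intr (reflected w *m M))).
    by rewrite scalerA mulrV // scale1r addrC subrK.
  have [R [RU RA [y yE]]] := reflected_local pr wW pc.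
  exists (R *m U p pr); split; first by rewrite unitmx_mul RU.
    by rewrite trmx_mul -RA -UA !mulmxA.
  exists (map_mx intr (reflected w) *m Y + y *m U p pr).
  rewrite mulmxA yE mulmxDl -scalemxAl scalerDr addrA; congr (_ + _).
  by rewrite {1}YE mulmxDr -scalemxAr map_mxM.
move=> w w' wW w'W XX; apply: (reflected_inj wW w'W).
have [x xE] := shifted_inj E'U c0 XX.
apply: (map_Zc_eq c1) => i.
apply: (dvdz_local c0) => p pr; have [UU UA] := UP p pr; have [Y YE] := MP p pr.
rewrite -mulmxBl in xE; exact: cancel_unit_cong UU YE xE i.
Qed.

End CosetFamily.

(** * Counting modulo c *)

Section Directions.
Variables (D : comNzRingType) (n : nat) (A : 'M[D]_n).
Hypothesis As : A^T = A.
Implicit Types x y w : 'rV[D]_n.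

Definition polar x y : D := (x *m A *m y^T) 0 0.

Lemma polarC x y : polar x y = polar y x.
Proof.
rewrite /polar; have -> : x *m A *m y^T = (y *m A *m x^T)^T.
  by rewrite !trmx_mul trmxK As mulmxA.
by rewrite mxE.
Qed.

Lemma polarDl x y w : polar (x + y) w = polar x w + polar y w.
Proof. by rewrite /polar !mulmxDl mxE. Qed.

Lemma polarZl k x w : polar (k *: x) w = k * polar x w.
Proof. by rewrite /polar -!scalemxAl mxE. Qed.

Lemma polarDr x y w : polar w (x + y) = polar w x + polar w y.
Proof. by rewrite /polar linearD /= mulmxDr mxE. Qed.

Lemma polarZr k x w : polar w (k *: x) = k * polar w x.
Proof. by rewrite /polar linearZ /= -scalemxAr mxE. Qed.

Lemma polar_line w x t :
  polar (w + t *: x) (w + t *: x) = polar w w + t * (polar w x * 2%:R) + t ^+ 2 * polar x x.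
Proof.
rewrite !polarDl !polarDr !polarZl !polarZr (polarC x w); ring.
Qed.

End Directions.

Lemma map_polar (R D : comNzRingType) (f : {rmorphism R -> D}) n (A : 'M[R]_n) x y :
  f (polar A x y) = polar (map_mx f A) (map_mx f x) (map_mx f y).
Proof. by rewrite /polar map_trmx -!map_mxM [RHS]mxE. Qed.

(* Along the direction x the form restricted to any line of the affine
   hyperplane B(z, w) = 1/2 is a nonzero polynomial of degree at most 2. *)
Lemma good_direction (F : fieldType) n (A : 'M[F]_n) (z w0 : 'rV[F]_n) : A^T = A ->
  polar A z w0 * 2%:R != 0 -> polar A w0 w0 != 0 ->
  exists2 x, polar A z x = 0 & forall w, polar A z w * 2%:R = 1 ->
    ~ [/\ polar A w w = 0, polar A w x * 2%:R = 0 & polar A x x = 0].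
Proof.
move=> As b0 q0; have two : 2%:R != 0 :> F by move: b0; rewrite mulf_eq0 negb_or => /andP[].
have [w1 b1 q1] : exists2 w1, polar A z w1 * 2%:R = 1 & polar A w1 w1 != 0.
  exists ((polar A z w0 * 2%:R)^-1 *: w0); first by rewrite polarZr -mulrA mulVf.
  by rewrite polarZl polarZr !mulf_neq0 ?invr_neq0.
have ker w : polar A z w * 2%:R = 1 -> polar A z (w - w1) = 0.
  move=> bw; apply: (mulIf two); rewrite -scaleN1r polarDr polarZr mulrDl -mulrA.
  by rewrite bw b1 mulN1r subrr mul0r.
have wE w : polar A z w * 2%:R = 1 -> exists2 k, w = w1 + 1 *: k & polar A z k = 0.
  by move=> bw; exists (w - w1); [rewrite scale1r addrC subrK|exact: ker].
(* Three cases. If some x orthogonal to z has Q(x) nonzero, the quadratic coefficient survives.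
   Otherwise B vanishes on the orthogonal complement of z; if some x there is not orthogonal to w1,
   the linear coefficient survives. Otherwise Q is constant on the affine hyperplane, equal to
   Q(w1), and x = 0 works. *)
have [[x bx qx]|Q0] := pselect (exists2 x, polar A z x = 0 & polar A x x != 0).
  by exists x => // w _ [_ _ /eqP]; rewrite (negPf qx).
have {}Q0 x : polar A z x = 0 -> polar A x x = 0.
  by move=> bx; apply/eqP/negPn/negP => qx; apply: Q0; exists x.
have B0 x y : polar A z x = 0 -> polar A z y = 0 -> polar A x y = 0.
  move=> bx by_; have := Q0 (x + 1 *: y); rewrite polarDr polarZr bx by_ mulr0 addr0.
  move=> /(_ erefl); rewrite polar_line // !Q0 // mulr0 addr0 add0r mul1r => /eqP.
  by rewrite mulf_eq0 (negPf two) orbF => /eqP.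
have [[x bx wx]|B1] := pselect (exists2 x, polar A z x = 0 & polar A w1 x != 0).
  exists x => // w bw [_ /eqP + _]; rewrite mulf_eq0 (negPf two) orbF.
  have [k -> bk] := wE w bw; rewrite polarDl polarZl (B0 k x bk bx) mulr0 addr0.
  by rewrite (negPf wx).
exists 0; first by rewrite -(scale0r 0) polarZr mul0r.
move=> w bw [/eqP + _ _]; have [k -> bk] := wE w bw; rewrite polar_line // (Q0 k bk).
have -> : polar A w1 k = 0.
  by apply/eqP/negPn/negP => qx; apply: B1; exists k.
by rewrite mul0r !mulr0 !addr0 (negPf q1).
Qed.

(** * Counting residues prime by prime *)

Section Sieve.

Definition cnt N (P : pred nat) : nat := #|[set t : 'I_N | P t]%SET|.

Lemma cnt_chinese a b (P R : pred nat) : coprime a b -> (0 < a)%N -> (0 < b)%N ->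
  (forall t, P t = P (t %% a)%N) -> (forall t, R t = R (t %% b)%N) ->
  (cnt a P * cnt b R <= cnt (a * b) (fun t => P t && R t))%N.
Proof.
move=> ab a0 b0 Pa Rb; have ab0 : (0 < a * b)%N by rewrite muln_gt0 a0.
have lt t : (t %% (a * b) < a * b)%N by rewrite ltn_mod.
pose f (u : 'I_a * 'I_b) := Ordinal (lt (chinese a b u.1 u.2)).
have fa u : (f u %% a = u.1)%N.
  by rewrite /= modn_dvdm ?dvdn_mulr // chinese_modl // modn_small.
have fb u : (f u %% b = u.2)%N.
  by rewrite /= modn_dvdm ?dvdn_mull // chinese_modr // modn_small.
have finj : injective f.
  move=> [i j] [i' j'] e; have := fa (i, j); have := fb (i, j).
  by rewrite e fa fb => /= /val_inj-> /val_inj->.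
rewrite /cnt -finset.cardsX -(card_imset _ finj); apply/subset_leq_card/fintype.subsetP => t.
move=> /imsetP[[i j]]; rewrite !inE /= => /andP[Pi Rj] ->.
by rewrite Pa fa Rb fb Pi.
Qed.

Lemma cnt_mul D m (P : pred nat) : (0 < D)%N -> (forall t, P t = P (t %% D)%N) ->
  (cnt D P * m <= cnt (D * m) P)%N.
Proof.
move=> D0 PD; have lt (u : 'I_D * 'I_m) : (u.1 + u.2 * D < D * m)%N.
  case: u => i k /=; apply: (@leq_trans (D + k * D)); first by rewrite ltn_add2r.
  by rewrite -mulSn mulnC leq_mul2l ltn_ord orbT.
pose f u := Ordinal (lt u).
have fD u : (f u %% D = u.1)%N by rewrite /= addnC modnMDl modn_small.
have fd u : (f u %/ D = u.2)%N by rewrite /= addnC divnMDl // divn_small // addn0.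
have finj : injective f.
  move=> [i j] [i' j'] e; have := fD (i, j); have := fd (i, j).
  by rewrite e fD fd => /= /val_inj-> /val_inj->.
rewrite /cnt -[m in X in (X <= _)%N]card_ord -cardsT -finset.cardsX -(card_imset _ finj).
apply/subset_leq_card/fintype.subsetP => t.
by move=> /imsetP[[i j]]; rewrite !inE /= andbT => Pi ->; rewrite PD fD.
Qed.

(** Conditions on t modulo distinct primes are independent by Chinese remaindering, so the lower
    bounds multiply. *)
Lemma sieve (s : seq nat) (P : nat -> pred nat) (m : nat -> nat) :
  uniq s -> all prime s -> (forall p t, p \in s -> P p t = P p (t %% p)%N) ->
  (forall p, p \in s -> m p <= cnt p (P p))%N ->
  (\prod_(p <- s) m p <= cnt (\prod_(p <- s) p) (fun t => all (fun p => P p t) s))%N.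
Proof.
elim: s => [|q s IH] /=.
  rewrite !big_nil /cnt => _ _ _ _.
  by rewrite (_ : [set t : 'I_1 | true]%SET = [set: 'I_1]%SET) ?cardsT ?card_ord.
move=> /andP[qs us] /andP[pq ps] Pper mP; rewrite !big_cons.
have s0 : (0 < \prod_(p <- s) p)%N.
  by rewrite big_seq prodn_cond_gt0 // => p /(allP ps)/prime_gt0.
apply: leq_trans (cnt_chinese _ (prime_gt0 pq) s0 _ _).
- apply: leq_mul; first by apply: mP; rewrite mem_head.
  apply: IH => // [p t ps'|p ps']; first by apply: Pper; rewrite inE ps' orbT.
  by apply: mP; rewrite inE ps' orbT.
- rewrite big_seq; apply: (big_ind (coprime _)) => [|x y cx cy|p ps'].
  + exact: coprimen1.
  + by rewrite coprimeMr cx.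
  rewrite prime_coprime // dvdn_prime2 //; last exact: (allP ps).
  by apply: contraNneq qs => ->.
- by move=> t; apply: Pper; rewrite mem_head.
move=> t; apply: eq_in_all => p ps'.
rewrite [LHS]Pper ?inE ?ps' ?orbT // [RHS]Pper ?inE ?ps' ?orbT //.
by rewrite modn_dvdm // (big_rem p) //= dvdn_mulr.
Qed.

End Sieve.

Lemma horner_deg2 (D : comNzRingType) (a b d x : D) :
  (Poly [:: a; b; d]).[x] = a + x * b + x ^+ 2 * d.
Proof. rewrite horner_Poly /=; ring. Qed.

Section ModP.
Variables (p : nat) (pr : prime p).

Lemma intr_Fp_eq0 (k : int) : (k%:~R == 0 :> 'F_p) = (p %| k)%Z.
Proof.
have := @intr_Zc_eq0 (pdiv p) k; rewrite pdiv_id // => -> //.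
exact: prime_gt1.
Qed.

(** A nonzero polynomial of degree at most 2 has at most two roots in F_p. *)
Lemma quadratic_count (q0 q1 q2 : int) :
  ~ [/\ (q0%:~R : 'F_p) = 0, (q1%:~R : 'F_p) = 0 & (q2%:~R : 'F_p) = 0] ->
  (p - 2 <= cnt p (fun t => ((q0 + t%:Z * q1 + t%:Z ^+ 2 * q2)%:~R : 'F_p) != 0%R))%N.
Proof.
move=> q012; pose f : {poly 'F_p} := Poly [:: q0%:~R; q1%:~R; q2%:~R].
have fE (t : nat) : ((q0 + t%:Z * q1 + t%:Z ^+ 2 * q2)%:~R : 'F_p) = f.[t%:R].
  by rewrite horner_deg2 !rmorphD !rmorphM.
have f0 : f != 0.
  apply/eqP => f0; apply: q012; split; [have := congr1 (fun g : {poly _} => g`_0) f0|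
    have := congr1 (fun g : {poly _} => g`_1) f0|have := congr1 (fun g : {poly _} => g`_2) f0];
  by rewrite /= coef_Poly coef0.
pose S := [set t : 'I_p | f.[(t : nat)%:R] == 0]%SET.
have S2 : (#|S| <= 2)%N.
  have injp (t t' : 'I_p) : (t : nat)%:R = (t' : nat)%:R :> 'F_p -> t = t'.
    move=> h; apply: val_inj; have := congr1 val h; rewrite /= !val_Fp_nat //.
    by rewrite !modn_small.
  have rt : all (root f) [seq (t : nat)%:R | t : 'I_p <- enum S].
    by apply/allP => _ /mapP[t + ->]; rewrite mem_enum inE.
  have un : uniq [seq ((t : nat)%:R : 'F_p) | t : 'I_p <- enum S].
    by rewrite map_inj_uniq ?enum_uniq.
  have := max_poly_roots f0 rt un; rewrite size_map -cardE => h.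
  by rewrite -ltnS; apply: (leq_trans h); apply: (leq_trans (size_Poly _)).
rewrite /cnt (_ : [set t : 'I_p | _]%SET = ~: S); last first.
  by apply/setP => t; rewrite !inE fE.
by rewrite cardsCs finset.setCK card_ord leq_sub2l.
Qed.

End ModP.

Lemma unit_Zc_Fp c (k : int) : (1 < c)%N ->
  ((k%:~R : 'Z_c) \is a GRing.unit) = all (fun p => (k%:~R : 'F_p) != 0) (primes c).
Proof.
move=> c1; have -> : ((k%:~R : 'Z_c) \is a GRing.unit) = coprime c `|k|%N.
  case: k => k; first by rewrite -pmulrn unitZpE.
  by rewrite NegzE mulrNz unitrN -pmulrn unitZpE // abszN.
apply/idP/allP => [ck p|H].
  rewrite mem_primes => /and3P[pr _ pc]; rewrite intr_Fp_eq0 //.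
  apply/negP => pk; have : (p %| gcdn c `|k|)%N by rewrite dvdn_gcd pc.
  by rewrite (eqP ck) dvdn1 => /eqP p1; move: pr; rewrite p1.
rewrite /coprime; apply/negPn/negP => g1.
have g2 : (1 < gcdn c `|k|)%N by rewrite ltn_neqAle eq_sym g1 gcdn_gt0 (ltnW c1).
have pg := pdiv_dvd (gcdn c `|k|); have pr := pdiv_prime g2.
move: pg; rewrite dvdn_gcd => /andP[pc pk].
have := H (pdiv (gcdn c `|k|)); rewrite mem_primes pr (ltnW c1) pc intr_Fp_eq0 //.
by rewrite dvdzE /= pk => /(_ isT).
Qed.

Lemma crt_rows c n (x : nat -> 'rV[int]_n) :
  exists y : 'rV[int]_n, forall p, p \in primes c ->
    map_mx intr y = map_mx intr (x p) :> 'rV['F_p]_n.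
Proof.
have /choice[y yP] (i : 'I_n) := chinese_seq (fun=> 1%N)
  (fun p => `|(x p 0%R i %% p%:Z)%Z|%N) (primes_uniq c) (all_prime_primes c).
exists (\row_i (y i)%:Z) => p pc; apply/rowP => i; rewrite !mxE.
have pr : prime p by move: pc; rewrite mem_primes => /and3P[].
have p0 : p%:Z != 0 by rewrite eqz_nat -lt0n prime_gt0.
apply/eqP; rewrite -subr_eq0 -rmorphB /= intr_Fp_eq0 // -eqz_mod_dvd.
have := yP i p pc; rewrite expn1 => h.
rewrite -[X in _ == X]modz_mod -[(x p 0%R i %% p)%Z]gez0_abs ?modz_ge0 //.
by rewrite !modz_nat h.
Qed.

Lemma prod_primes_dvd c : (0 < c)%N -> (\prod_(p <- primes c) p %| c)%N.
Proof.
move=> c0; rewrite {2}(prod_prime_decomp c0) prime_decompE big_map /=.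
rewrite big_seq [X in (_ %| X)%N]big_seq.
apply: (big_ind2 (fun a b => a %| b)%N) => [//|*|p pc]; first exact: dvdn_mul.
by rewrite dvdn_exp // logn_gt0.
Qed.

(** * The number of admissible reflection vectors modulo c *)

Section UnitVectorCount.
Variables (n : nat) (A : 'M[int]_n) (c : nat) (z : 'rV[int]_n).
Hypotheses (As : A^T = A) (c1 : (1 < c)%N).
Hypothesis good : forall p, p \in primes c -> exists w : 'rV[int]_n,
  ((polar A z w * 2)%:~R : 'F_p) != 0 /\ ((polar A w w)%:~R : 'F_p) != 0.

Let c0 : (0 < c)%N := ltnW c1.
Local Notation AZ := (map_mx (intr : int -> 'Z_c) A).
Local Notation zZ := (map_mx (intr : int -> 'Z_c) z).

(** Local solutions glue to a vector at which 2 B(z, .) is nonzero modulo every p | c, that is a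
    unit modulo c; rescaling makes the value 1. *)
Lemma good_vector : exists w : 'rV['Z_c]_n, polar AZ zZ w * 2%:R = 1.
Proof.
have /choice[w wP] p : exists w : 'rV[int]_n, p \in primes c ->
    ((polar A z w * 2)%:~R : 'F_p) != 0.
  have [/good[w [h _]]|_] := boolP (p \in primes c); first by exists w.
  by exists 0.
have [y yP] := crt_rows c w.
have yU : ((polar A z y * 2)%:~R : 'Z_c) \is a GRing.unit.
  rewrite unit_Zc_Fp //; apply/allP => p pc.
  by have := wP p pc; rewrite !rmorphM /= !(map_polar intr) yP.
exists (((polar A z y * 2)%:~R)^-1 *: map_mx intr y).
rewrite polarZr -mulrA -(map_polar intr).
by rewrite -[RHS](mulVr yU) rmorphM.
Qed.

Lemma Zc_eq0_Fp (k : int) p : p \in primes c -> (k%:~R : 'Z_c) = 0 -> (k%:~R : 'F_p) = 0.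
Proof.
rewrite mem_primes => /and3P[pr _ pc] /eqP; rewrite intr_Zc_eq0 // => ck.
apply/eqP; rewrite intr_Fp_eq0 //.
by apply: dvdz_trans ck; rewrite dvdzE.
Qed.

Lemma Zc_eq_Fp_row (u v : 'rV[int]_n) p : p \in primes c ->
  map_mx intr u = map_mx intr v :> 'rV['Z_c]_n ->
  map_mx intr u = map_mx intr v :> 'rV['F_p]_n.
Proof.
move=> pc /rowP uv; apply/rowP => i; have := uv i; rewrite !mxE => uvi.
apply/eqP; rewrite -subr_eq0 -rmorphB; apply/eqP/Zc_eq0_Fp => //.
by rewrite rmorphB /= uvi subrr.
Qed.

Lemma good_direction_Zc : exists x : 'rV['Z_c]_n, polar AZ zZ x = 0 /\
  forall w, polar AZ zZ w * 2%:R = 1 ->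
  forall p, p \in primes c ->
  ~ [/\ ((polar A (lift_Zc w) (lift_Zc w))%:~R : 'F_p) = 0,
        ((polar A (lift_Zc w) (lift_Zc x) * 2)%:~R : 'F_p) = 0 &
        ((polar A (lift_Zc x) (lift_Zc x))%:~R : 'F_p) = 0].
Proof.
have /choice[x xP] p : exists x : 'rV[int]_n, p \in primes c ->
    let f (m : int) : 'F_p := m%:~R in
    polar (map_mx f A) (map_mx f z) (map_mx f x) = 0 /\
    forall w, polar (map_mx f A) (map_mx f z) w * 2%:R = 1 ->
    ~ [/\ polar (map_mx f A) w w = 0, polar (map_mx f A) w (map_mx f x) * 2%:R = 0 &
       polar (map_mx f A) (map_mx f x) (map_mx f x) = 0].
  have [/good[w0 [b0 q0]]|_] := boolP (p \in primes c); last by exists 0.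
  have Asp : (map_mx intr A : 'M['F_p]_n)^T = map_mx intr A by rewrite map_trmx As.
  rewrite rmorphM /= (map_polar intr) in b0; rewrite (map_polar intr) in q0.
  have [x bx xP] := good_direction Asp b0 q0.
  by exists (lift_Zc x) => _; rewrite /= lift_ZcK.
have [y yP] := crt_rows c x; have [w1 w1b] := good_vector.
(* The glued direction y is orthogonal to z only modulo each p. The correction makes this exact
   modulo c, since 2 B(z, w1) = 1, and does not change y modulo p, its coefficient being 0 there. *)
pose v := y - (polar A z y * 2) *: lift_Zc w1.
have polarD_sub u1 u2 (k : 'Z_c) : polar AZ zZ (u1 - k *: u2) = polar AZ zZ u1 - k * polar AZ zZ u2.
  by rewrite -scaleNr polarDr polarZr mulNr.
exists (map_mx intr v); split.
  rewrite map_intr_subZ lift_ZcK polarD_sub rmorphM /= (map_polar intr).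
  by rewrite -mulrA [2%:~R * _]mulrC w1b mulr1 subrr.
move=> w wb p pc; have [bx xPp] := xP p pc.
have lv : map_mx intr (lift_Zc (map_mx intr v : 'rV['Z_c]_n)) = map_mx intr (x p) :> 'rV['F_p]_n.
  rewrite (@Zc_eq_Fp_row _ v p pc) ?lift_ZcK // map_intr_subZ yP //.
  by rewrite rmorphM /= (map_polar intr) yP // bx mul0r scale0r subr0.
have wbp : polar (map_mx intr A) (map_mx intr z) (map_mx intr (lift_Zc w)) * 2%:R = 1 :> 'F_p.
  apply/eqP; rewrite -subr_eq0 -(map_polar intr).
  have := @Zc_eq0_Fp (polar A z (lift_Zc w) * 2 - 1) p pc.
  rewrite !rmorphB !rmorphM /= (map_polar intr) lift_ZcK wb subrr => /(_ erefl).
  by move=> ->.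
move=> [h1 h2 h3]; apply: (xPp _ wbp); split.
- by rewrite -(map_polar intr).
- by rewrite -lv -(map_polar intr) -h2 rmorphM.
- by rewrite -lv -(map_polar intr).
Qed.

Local Notation b w := (polar AZ zZ w * 2%:R).
Local Notation isU w := (polar AZ w w \is a GRing.unit).

(** The c fibres of w -> 2 B(z, w) are translates of one another along a vector of value 1, so they
    share the c^n vectors equally. *)
Lemma card_hyperplane : (c * #|[set w | b w == 1%R]%SET| = c ^ n)%N.
Proof.
have [w1 w1b] := good_vector.
have cE : #|{: 'Z_c}| = c by rewrite card_ord Zp_cast.
have fib s : #|[set w | b w == s]%SET| = #|[set w | b w == 1%R]%SET|.
  rewrite -!sum1dep_card (reindex_inj (addIr ((s - 1) *: w1))) /=.
  apply: eq_bigl => w; rewrite polarDr polarZr mulrDl -mulrA w1b mulr1.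
  by rewrite -[X in _ == X](subrK 1) addrC (inj_eq (addrI _)).
have : (#|{: 'rV['Z_c]_n}| = \sum_(s : 'Z_c) #|[set w | b w == s]%SET|)%N.
  rewrite -sum1_card (partition_big (fun w => b w) predT) //=.
  by apply: eq_bigr => s _; rewrite -sum1dep_card.
under eq_bigr => s _ do rewrite fib.
by rewrite sum_nat_const cE card_mx cE mul1n => <-.
Qed.

(** Along the line the norm is a quadratic polynomial in t, and it is a unit exactly when it
    vanishes modulo no p | c. The hypothesis keeps this polynomial nonzero modulo each p. *)
Lemma line_count (w x : 'rV['Z_c]_n) :
  (forall p, p \in primes c ->
  ~ [/\ ((polar A (lift_Zc w) (lift_Zc w))%:~R : 'F_p) = 0,
        ((polar A (lift_Zc w) (lift_Zc x) * 2)%:~R : 'F_p) = 0 &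
        ((polar A (lift_Zc x) (lift_Zc x))%:~R : 'F_p) = 0]) ->
  (c %/ \prod_(p <- primes c) p * \prod_(p <- primes c) (p - 2)
    <= #|[set t : 'Z_c | isU (w + t *: x)]%SET|)%N.
Proof.
move=> H; set W := lift_Zc w in H; set X := lift_Zc x in H.
pose f (t : nat) : int := polar A W W + t%:Z * (polar A W X * 2) + t%:Z ^+ 2 * polar A X X.
pose P p (t : nat) := ((f t)%:~R : 'F_p) != 0.
have fE (t : 'Z_c) : polar AZ (w + t *: x) (w + t *: x) = (f t)%:~R.
  have AsZ : AZ^T = AZ by rewrite map_trmx As.
  rewrite polar_line // /f !rmorphD !rmorphM /= !(map_polar intr) !lift_ZcK.
  by rewrite nat_intr_Zc.
have -> : #|[set t : 'Z_c | isU (w + t *: x)]%SET| = cnt c (fun t => all (fun p => P p t) (primes c)).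
  set F := (X in cnt c X); have <- : cnt (Zp_trunc c).+2 F = cnt c F by rewrite Zp_cast.
  rewrite /cnt /F; apply: eq_card => t; rewrite !inE.
  by rewrite fE unit_Zc_Fp.
have D0 : (0 < \prod_(p <- primes c) p)%N.
  by rewrite big_seq prodn_cond_gt0 // => p; rewrite mem_primes => /and3P[/prime_gt0].
have Dc := prod_primes_dvd c0.
have Pper p t : p \in primes c -> P p t = P p (t %% p)%N.
  rewrite mem_primes => /and3P[pr _ _]; rewrite /P /f; congr (_ != 0).
  rewrite !rmorphD !rmorphM /=.
  by have -> : (t%:Z%:~R : 'F_p) = (t %% p)%N%:Z%:~R by rewrite -!pmulrn Fp_nat_mod.
have S := sieve (primes_uniq c) (all_prime_primes c) Pper.
(* Being a unit depends on t only modulo the product D of the primes dividing c, so each good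
   residue modulo D occurs c / D times. *)
rewrite -[c in cnt c _](divnK Dc) [X in cnt X _]mulnC mulnC.
apply: leq_trans (cnt_mul _ D0 _).
  rewrite leq_mul2r; apply/orP; right; apply: S => p pc.
  have pr : prime p by move: pc; rewrite mem_primes => /and3P[].
  exact: (quadratic_count pr (H p pc)).
move=> t; apply: eq_in_all => p pc; rewrite [LHS]Pper // [RHS]Pper //.
by rewrite modn_dvdm // (big_rem p) //= dvdn_mulr.
Qed.

(** Double counting of the pairs (w, t) with w + t x of unit norm: translation by t x permutes the
    hyperplane, so each t contributes the same number. Counting pairs instead of lines is
    insensitive to directions x with repeated points. One factor c comes from the size of the
    hyperplane, the other from the range of t. *)
Lemma unit_vectors_count :
  (c ^ n * (c %/ \prod_(p <- primes c) p * \prod_(p <- primes c) (p - 2))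
    <= c ^ 2 * #|unit_vectors A c z|)%N.
Proof.
have [x [bx xP]] := good_direction_Zc.
have cE : #|{: 'Z_c}| = c by rewrite card_ord Zp_cast.
set N := (_ %/ _ * _)%N; rewrite -card_hyperplane -mulnA expnS expn1 -mulnA leq_mul2l.
apply/orP; right; set H := [set w | _]%SET.
have Hx w t : (w + t *: x \in H) = (w \in H).
  by rewrite !inE polarDr polarZr bx mulr0 addr0.
have -> : (c * #|unit_vectors A c z| = \sum_(w in H) #|[set t : 'Z_c | isU (w + t *: x)]%SET|)%N.
  under [RHS]eq_bigr => w _ do rewrite -sum1dep_card big_mkcond.
  rewrite exchange_big /=.
  transitivity (\sum_(t : 'Z_c) #|unit_vectors A c z|)%N; first by rewrite sum_nat_const cE.
  apply: eq_bigr => t _; rewrite -sum1_card.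
  rewrite (reindex_inj (addIr (t *: x))) /= -big_mkcondr; apply: eq_bigl => w.
  by rewrite -(Hx w t) !inE.
rewrite -sum_nat_const; apply: leq_sum => w; rewrite inE => /eqP wb.
exact: line_count (xP w wb).
Qed.

End UnitVectorCount.

(** * Orbit counting *)

Lemma carries_shifted n (E s : 'M[rat]_n) c (z : 'rV[int]_n) :
  carries s (shifted E c z) (shifted (E *m s) c z).
Proof.
apply/seteqP; split=> v /=.
  move=> [_ [_ [x _ <-] <-] <-]; exists (map_mx intr x *m (E *m s)); first by exists x.
  by rewrite mulmxDl -!scalemxAl !mulmxA.
move=> [_ [x _ <-] <-]; exists (map_mx intr x *m E + c%:R^-1 *: (map_mx intr z *m E)).
  by exists (map_mx intr x *m E) => //; exists x.
by rewrite mulmxDl -!scalemxAl !mulmxA.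
Qed.

Lemma shifted1 n (E : 'M[rat]_n) (z : 'rV[int]_n) : shifted E 1 z = zspan E.
Proof. by rewrite /shifted invr1 scale1r -[_ *m _]addr0 translate_zspan translate0. Qed.

Lemma fset_set_imageP (U : Type) (V : choiceType) (f : U -> V) (A : set U) x :
  finite_set (f @` A) ->
  x \in (fset_set (f @` A) : seq V) <-> exists2 y, A y & f y = x.
Proof. by move=> fA; rewrite in_fset_set // inE. Qed.

Lemma card_fset_set_le (T U : choiceType) (I : finType) (W : {set I}) (A : set T)
    (B : set U) (g : I -> T -> U) : finite_set A -> finite_set B ->
  (forall w t, w \in W -> A t -> B (g w t)) ->
  (forall w w' t t', w \in W -> w' \in W -> A t -> A t' -> g w t = g w' t' -> w = w' /\ t = t') ->
  (#|W| * #|` fset_set A| <= #|` fset_set B|)%N.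
Proof.
move=> fA fB gB ginj.
have mA t : t \in (fset_set A : seq T) -> A t by rewrite in_fset_set // inE.
rewrite cardE -(size_allpairs g); apply: uniq_leq_size.
  apply: allpairs_uniq; [exact: enum_uniq|exact: fset_uniq|].
  move=> [w t] [w' t'] /allpairsP[[w1 t1] /= [w1W t1A [-> ->]]].
  move=> /allpairsP[[w2 t2] /= [w2W t2A [-> ->]]] e.
  rewrite mem_enum in w1W; rewrite mem_enum in w2W.
  by have [-> ->] := ginj _ _ _ _ w1W w2W (mA _ t1A) (mA _ t2A) e.
move=> _ /allpairsP[[w t] /= [wW tA ->]]; rewrite mem_enum in wW.
by rewrite in_fset_set // inE; apply: gB => //; exact: mA.
Qed.

(** The skeleton of the orbit count: i runs over classes of lattices, j over reflection vectors, k
    over classes of cosets, while F and H are inverse group orders. A class of cosets receives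
    contributions from one class of lattices only, so fibres can be compared one at a time. *)
Lemma sum_fibers_le (R : numDomainType) (I K : eqType) (J : finType) (W : {set J})
    (r : seq I) (q : seq K) (f : I -> J -> K) (F : I -> R) (H : K -> R) :
  uniq r -> uniq q -> (forall k, 0 <= H k) ->
  (forall i j, i \in r -> j \in W -> f i j \in q) ->
  (forall i i' j j', i \in r -> i' \in r -> j \in W -> j' \in W ->
     f i j = f i' j' -> i = i') ->
  (forall i j, i \in r -> j \in W ->
     #|[set j' in W | f i j' == f i j]%SET|%:R * F i <= H (f i j)) ->
  #|W|%:R * (\sum_(i <- r) F i) <= \sum_(k <- q) H k.
Proof.
move=> ur uq H0 fq finj FH.
pose S i k := \sum_(j in W | f i j == k) F i.
have SE i k : S i k = #|[set j in W | f i j == k]%SET|%:R * F i.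
  by rewrite mulr_natl -sumr_const; apply: eq_bigl => j; rewrite inE.
have -> : #|W|%:R * (\sum_(i <- r) F i) = \sum_(k <- q) \sum_(i <- r) S i k.
  rewrite mulr_sumr exchange_big /= big_seq [RHS]big_seq; apply: eq_bigr => i ir.
  rewrite mulr_natl -sumr_const; under [RHS]eq_bigr do rewrite /S big_mkcondr.
  rewrite exchange_big /=; apply: eq_bigr => j jW.
  rewrite -big_mkcond /= -big_filter (@eq_filter _ _ (pred1 (f i j))); last first.
    by move=> k /=; rewrite eq_sym.
  by rewrite filter_pred1_uniq ?fq // big_seq1.
apply: ler_sum => k _.
have [[i [j [ir jW <-]]]|none] :=
    pselect (exists i j, [/\ i \in r, j \in W & f i j = k]).
  rewrite (big_rem i) //= [X in _ + X]big_seq [X in _ + X]big1 ?addr0; last first.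
    move=> i'; rewrite mem_rem_uniq // inE => /andP[/eqP i'i i'r].
    rewrite /S big1 // => j' /andP[j'W /eqP h]; case: i'i.
    exact: finj h.
  by rewrite SE; exact: FH.
rewrite big_seq big1 // => i ir; rewrite /S big1 // => j /andP[jW /eqP h].
by case: none; exists i, j.
Qed.

Lemma natr_div_le_inv (R : numFieldType) (m a b : nat) : (0 < a)%N -> (0 < b)%N ->
  (m * b <= a)%N -> m%:R / a%:R <= (b%:R)^-1 :> R.
Proof.
move=> ap bp h; rewrite ler_pdivrMr ?ltr0n // mulrC ler_pdivlMr ?ltr0n //.
by rewrite -natrM ler_nat.
Qed.

Lemma massE n (G : 'M[rat]_n) K w : finite_set (class_rep G @` genus G K w) ->
  mass G K w = \sum_(X <- fset_set (class_rep G @` genus G K w))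
     (#|` fset_set (autos G X)|%:R)^-1.
Proof. exact: fsbig_finite. Qed.

Section MassBound.
Variables (n : nat) (G E : 'M[rat]_n) (A : 'M[int]_n) (a : 'I_n -> nat).
Hypotheses (EU : E \in unitmx) (EA : E *m sym_part G *m E^T = map_mx intr A).
Hypotheses (a0 : forall j, (0 < a j)%N) (Aa : A = diag_mx (\row_j (a j)%:Z)).

Let AT : A^T = A. Proof. by rewrite Aa tr_diag_mx. Qed.

Lemma genus_class c z X Y : (0 < c)%N ->
  genus G (zspan E) (c%:R^-1 *: (map_mx intr z *m E)) X -> class G X Y ->
  genus G (zspan E) (c%:R^-1 *: (map_mx intr z *m E)) Y.
Proof.
move=> c0 /(genus_coord z EU EA c0)[E' [A' [z' [E'U E'A -> loc]]]] [s].
move=> /isometriesP[//|sU sG] <-; apply/(genus_coord z EU EA c0).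
exists (E' *m s), A', z'; split=> //; first by rewrite unitmx_mul E'U.
  by rewrite trmx_mul !mulmxA -(mulmxA E') -(mulmxA E') sG.
exact: carries_shifted.
Qed.

Lemma genus_finite_autos c z X : (0 < c)%N ->
  genus G (zspan E) (c%:R^-1 *: (map_mx intr z *m E)) X -> finite_set (autos G X).
Proof.
move=> c0 /(genus_coord z EU EA c0)[E' [A' [z' [E'U _ -> _]]]].
exact: (finite_autos c EU EA a0 Aa z' E'U).
Qed.

(** With denominator 1, the results on cosets apply to the lattice itself. *)
Lemma zero_shift : 0 = 1%:R^-1 *: (map_mx intr 0 *m E) :> 'rV[rat]_n.
Proof. by rewrite map_mx0 mul0mx scaler0. Qed.

Definition aut_order X := #|` fset_set (autos G X)|%N.

Lemma aut_order_gt0 X : finite_set (autos G X) -> (0 < aut_order X)%N.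
Proof.
move=> fX; rewrite /aut_order cardfs_gt0; apply/fset0Pn; exists 1%:M.
by rewrite in_fset_set // inE; split; [exact: isometries1|exact: carries1].
Qed.

Lemma genus_self : genus G (zspan E) 0 (zspan E).
Proof.
rewrite zero_shift; apply/(genus_coord 0 EU EA (ltn0Sn 0)).
exists E, A, 0; split=> //; first by rewrite shifted1.
move=> p pr; exists 1%:M; split; first exact: unitmx1.
  by rewrite trmx1 mulmx1 mul1mx.
by exists 0; rewrite mulmx1 scaler0 addr0.
Qed.

Lemma mass_gt0 : 0 < mass G (zspan E) 0.
Proof.
rewrite /mass {1}zero_shift fsbig_finite; last exact: (finite_classes 0 EU EA a0 (ltn0Sn 0) Aa).
set S := fset_set _; have rS : class_rep G (zspan E) \in S.
  rewrite in_fset_set; last exact: (finite_classes 0 EU EA a0 (ltn0Sn 0) Aa).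
  by rewrite inE -zero_shift; exists (zspan E) => //; exact: genus_self.
rewrite (big_rem _ rS) /= ltr_pwDl //; last by apply: sumr_ge0 => X _; rewrite invr_ge0.
rewrite invr_gt0 ltr0n -/(aut_order _); apply: aut_order_gt0.
apply: (@genus_finite_autos 1 0) => //; apply: (@genus_class 1 0 (zspan E)) => //.
  by rewrite -zero_shift; exact: genus_self.
exact: class_repP.
Qed.

(** The coset determines its lattice, so cosets of inequivalent lattices are inequivalent. For one
    K, the number of chosen cosets in the class of X times the order of O(X) is at most the order of
    O(K), as in the orbit formula; dividing by both orders compares the two masses. *)
Lemma mass_ratio c z : (1 < c)%N ->
  #|unit_vectors A c z|%:R * mass G (zspan E) 0
    <= mass G (zspan E) (c%:R^-1 *: (map_mx intr z *m E)).
Proof.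
move=> c1; have c0 := ltnW c1; set W := unit_vectors A c z.
set w0 := c%:R^-1 *: _.
have fK : finite_set (class_rep G @` genus G (zspan E) 0).
  by rewrite {1}zero_shift; exact: (finite_classes 0 EU EA a0 (ltn0Sn 0) Aa).
have fX : finite_set (class_rep G @` genus G (zspan E) w0).
  exact: (finite_classes z EU EA a0 c0 Aa).
rewrite (massE fK) (massE fX).
have memK K : K \in (fset_set (class_rep G @` genus G (zspan E) 0) : seq _) ->
    genus G (zspan E) 0 K /\ class_rep G K = K.
  move=> /(fset_set_imageP _ fK)[K0 K0g <-]; split; last first.
    by apply/class_rep_eqP/class_sym/class_repP.
  have := @genus_class 1 0 K0 (class_rep G K0) (ltn0Sn 0).
  by rewrite -zero_shift; apply => //; exact: class_repP.
have /choice[EF EFP] (K : set 'rV[rat]_n) : exists Ef : 'M[rat]_n * ('rV['Z_c]_n -> 'rV[int]_n),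
    genus G (zspan E) 0 K -> [/\ Ef.1 \in unitmx, K = zspan Ef.1,
    forall w, w \in W -> genus G (zspan E) w0 (shifted Ef.1 c (Ef.2 w)) &
    {in W &, forall w w', shifted Ef.1 c (Ef.2 w) = shifted Ef.1 c (Ef.2 w') -> w = w'}].
  have [gK|ngK] := pselect (genus G (zspan E) 0 K); last by exists (0, fun=> 0).
  by have [E' [f H]] := coset_family z EU EA AT c1 gK; exists (E', f).
pose coset K w := shifted (EF K).1 c ((EF K).2 w).
apply: (@sum_fibers_le _ _ _ _ _ _ _ (fun K w => class_rep G (coset K w))).
- exact: fset_uniq.
- exact: fset_uniq.
- by move=> X; rewrite invr_ge0 ler0n.
- move=> K w /memK[gK _] wW; apply/(fset_set_imageP _ fX).
  have [_ _ h _] := EFP K gK; exists (coset K w); [exact: h|by []].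
- move=> K K' w w' /memK[gK repK] /memK[gK' repK'] wW w'W h.
  have [_ KE _ _] := EFP K gK; have [_ K'E _ _] := EFP K' gK'.
  rewrite -repK' -repK; apply/class_rep_eqP.
  have [s sI sC] : class G (coset K w) (coset K' w') by apply/class_rep_eqP.
  by exists s; [exact: sI|rewrite K'E KE; exact: class_zspan sI sC].
move=> K w1 /memK[gK repK] w1W; have [E'U KE cosG cosI] := EFP K gK.
set X := class_rep G (coset K w1).
have gX : genus G (zspan E) w0 X by apply: (genus_class c0 (cosG _ w1W)); exact: class_repP.
have fautX := genus_finite_autos c0 gX; have aX := aut_order_gt0 fautX.
have fautK : finite_set (autos G K).
  by rewrite KE -(shifted1 (EF K).1 0); exact: (finite_autos 1 EU EA a0 Aa 0 E'U).
have aK := aut_order_gt0 fautK.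
set fib := finset _.
apply: (natr_div_le_inv _ aK aX).
have /choice[s sP] w : exists s, w \in fib -> isometries G s /\ carries s X (coset K w).
  have [wf|wf] := boolP (w \in fib); last by exists 0.
  have : class G X (coset K w).
    by move: wf; rewrite inE => /andP[_ /eqP wX]; apply: class_sym; rewrite -wX; exact: class_repP.
  by move=> [t tI tC]; exists t.
have w1f : w1 \in fib by rewrite inE w1W eqxx.
have [s1I s1C] := sP w1 w1f; have s1U := s1I.1.
(* With s_w carrying X to the coset of w, the product s_w1^-1 t s_w carries the coset of w1 to that
   of w and hence preserves K. From the product one recovers first w, through the image of the coset
   of w1, and then t. *)
apply: (card_fset_set_le (g := fun w t => invmx (s w1) *m t *m s w) fautX fautK).
  move=> w t wf [tI tC]; have [sI sC] := sP w wf.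
  split; first by apply: isometriesM sI; apply: isometriesM tI; exact: isometriesV.
  rewrite {1 2}KE; apply: (class_zspan (G := G) (c := c) (z1 := (EF K).2 w1) (z2 := (EF K).2 w)).
    by apply: isometriesM sI; apply: isometriesM tI; exact: isometriesV.
  by apply: carriesM sC; apply: carriesM tC; exact: carriesV.
move=> w w' t t' wf wf' [tI tC] [t'I t'C] e.
have [sI sC] := sP w wf; have [sI' sC'] := sP w' wf'.
have {}e : t *m s w = t' *m s w'.
  by apply: (can_inj (mulKmx (_ : invmx (s w1) \in unitmx))); rewrite ?unitmx_inv // !mulmxA.
have ww : w = w'.
  apply: cosI.
  - by move: wf; rewrite inE => /andP[].
  - by move: wf'; rewrite inE => /andP[].
  have h1 := carriesM tC sC; have h2 := carriesM t'C sC'.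
  by rewrite -/(coset K w) -/(coset K w') -h1 -h2 e.
split=> //; rewrite -ww in e.
by apply: (can_inj (mulmxK sI.1)).
Qed.

End MassBound.

(** * The mass inequality *)

Lemma polar_diag (D : comNzRingType) n (d : 'rV[D]_n) (x : 'rV[D]_n) i :
  polar (diag_mx d) x (delta_mx 0 i) = x 0 i * d 0 i.
Proof. by rewrite /polar trmx_delta -colE mxE mul_mx_diag mxE. Qed.

Lemma gram_diag l (G E : 'M[rat]_l) (a : 'I_l -> nat) :
  (forall x : 'rV[rat]_l, qform G (x *m E) = \sum_(j < l) (a j)%:R * x 0 j ^+ 2) ->
  E *m sym_part G *m E^T = map_mx intr (diag_mx (\row_j (a j)%:Z)).
Proof.
move=> H; apply/eqP; rewrite -subr_eq0; apply/eqP/form_eq0 => //.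
  by rewrite linearB /= !trmx_mul trmxK sym_part_tr map_diag_mx tr_diag_mx mulmxA.
move=> v; rewrite mulmxBr mulmxBl mxE [X in _ + X]mxE (diag_form (erefl _)).
by rewrite -H qform_sym_part // trmx_mul !mulmxA subrr.
Qed.

Lemma odd_prime_gt2 c p : odd c -> p \in primes c -> [/\ prime p, (p %| c)%N & (2 < p)%N].
Proof.
move=> oc; rewrite mem_primes => /and3P[pr _ pc]; split=> //.
rewrite ltn_neqAle prime_gt1 // andbT; apply: contraL pc => /eqP <-.
by rewrite dvdn2 oc.
Qed.

(** If p does not divide Q(u), then w = u works. Otherwise the gcd condition makes d_L prime to p,
    and primitivity gives a coordinate z_i prime to p; then B(u, e_i) = a_i z_i and Q(e_i) = a_i are
    nonzero modulo p. *)
Lemma good_vector_mod l (G E : 'M[rat]_l) (a : 'I_l -> nat) (z : 'rV[int]_l) c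
    (A := diag_mx (\row_j (a j)%:Z)) :
  E *m sym_part G *m E^T = map_mx intr A ->
  primitive (zspan E) (map_mx intr z *m E) -> odd c ->
  gcdn (gcdn (\prod_(j < l) a j) `|numq (qform G (map_mx intr z *m E))|) c = 1%N ->
  forall p, p \in primes c -> exists w : 'rV[int]_l,
    ((polar A z w * 2)%:~R : 'F_p) != 0 /\ ((polar A w w)%:~R : 'F_p) != 0.
Proof.
move=> gram [_ prim] oc g1 p pc; have [pr pdc p2] := odd_prime_gt2 oc pc.
have two : (2%:~R : 'F_p) != 0.
  by rewrite intr_Fp_eq0 // dvdzE /= gtnNdvd.
have qE : qform G (map_mx intr z *m E) = (polar A z z)%:~R.
  rewrite (map_polar intr) qform_sym_part // /polar -gram trmx_mul !mulmxA //.
rewrite qE numq_int in g1.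
have [pq|pq] := boolP (((polar A z z)%:~R : 'F_p) == 0); last first.
  by exists z; rewrite rmorphM mulf_neq0.
have pa : ~~ (p %| \prod_(j < l) a j)%N.
  apply/negP => pa; rewrite intr_Fp_eq0 // dvdzE /= in pq.
  have : (p %| gcdn (gcdn (\prod_(j < l) a j) `|polar A z z|) c)%N.
    by rewrite !dvdn_gcd pa pq.
  by rewrite g1 dvdn1 => /eqP p1; move: pr; rewrite p1.
have [i zi] : exists i, ~~ (p %| z 0%R i)%Z.
  apply: contrapT => H; apply: (prim p pr).
  exists (map_mx intr (map_mx (fun k : int => (k %/ p)%Z) z) *m E).
    by exists (map_mx (fun k : int => (k %/ p)%Z) z).
  rewrite scalemxAl; congr (_ *m _); apply/rowP => i; rewrite !mxE.
  have : (p %| z 0%R i)%Z by apply/negPn/negP => h; apply: H; exists i.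
  by move=> /divzK {1}<-; rewrite intrM mulrC.
exists (delta_mx 0 i).
have ai : ~~ (p %| a i)%N.
  by apply: contra pa => pai; rewrite (bigD1 i) //= dvdn_mulr.
rewrite !polar_diag !mxE !eqxx /= mul1r rmorphM rmorphM /=; split.
  by rewrite !mulf_neq0 // intr_Fp_eq0.
by rewrite intr_Fp_eq0.
Qed.

(** The upper bound compares f_p with the proportion 1 - 2/p supplied by the reflections; the lower
    bound, an equality at p = 3, serves the estimate uniform in c. *)
Lemma fp_bounds p : (2 < p)%N -> 9%:R^-1 <= fp p /\ fp p <= (p - 2)%:R / p%:R.
Proof.
have aux (F : realFieldType) (x i : F) : 4%:R <= x -> 0 < i -> x * i = 1 ->
    9%:R^-1 <= 2%:R^-1 - 3%:R / 2%:R * i /\ 2%:R^-1 - 3%:R / 2%:R * i <= (x - 2%:R) * i.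
  move=> x4 i0 xi; have := ler_wpM2r (ltW i0) x4; rewrite xi mulrBl xi => h.
  by split; lra.
have aux3 (F : realFieldType) : 9%:R^-1 <= (3%:R - 2%:R) / 3%:R :> F by lra.
move=> p2; have p0 : 0 < p%:R :> rat by rewrite ltr0n; lia.
rewrite /fp natrB ?(ltnW p2) //; case: eqP => [->|/eqP p3].
  by split; [exact: lexx|exact: aux3].
have p4 : 4%:R <= p%:R :> rat by rewrite ler_nat; lia.
have -> : 3%:R / (2 * p)%:R = 3%:R / 2%:R * p%:R^-1 :> rat by rewrite natrM invfM mulrA.
apply: aux => //; first by rewrite invr_gt0.
by rewrite mulfV // gt_eqF.
Qed.

Lemma unit_vectors_ge l (A : 'M[int]_l) c (z : 'rV[int]_l) : A^T = A ->
  (0 < l)%N -> (1 < c)%N -> odd c ->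
  (forall p, p \in primes c -> exists w : 'rV[int]_l,
    ((polar A z w * 2)%:~R : 'F_p) != 0 /\ ((polar A w w)%:~R : 'F_p) != 0) ->
  c%:R ^+ l.-1 * \prod_(p <- primes c) fp p <= #|unit_vectors A c z|%:R :> rat.
Proof.
move=> As l0 c1 oc good; have cQ : 0 < c%:R :> rat by rewrite ltr0n ltnW.
have := unit_vectors_count As c1 good; set D := \prod_(p <- primes c) p.
have Dc : (D %| c)%N := prod_primes_dvd (ltnW c1).
have D0 : (0 < D)%N by apply: dvdn_gt0 Dc; exact: ltnW.
rewrite -(ler_nat rat) !natrM !natrX natr_prod => H.
have -> : #|unit_vectors A c z|%:R = c%:R ^+ 2 * #|unit_vectors A c z|%:R / c%:R ^+ 2 :> rat.
  by rewrite mulrAC mulfV ?mul1r // expf_neq0 // gt_eqF.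
rewrite ler_pdivlMr ?exprn_gt0 //; apply: le_trans H.
have -> : (c %/ D)%:R = c%:R * \prod_(p <- primes c) p%:R^-1 :> rat.
  apply: (mulIf (_ : D%:R != 0)); first by rewrite pnatr_eq0 -lt0n.
  rewrite -natrM divnK // -mulrA prodfV natr_prod mulVf ?mulr1 //.
  by rewrite -natr_prod pnatr_eq0 -lt0n.
have -> : (c%:R ^+ l = c%:R ^+ l.-1 * c%:R :> rat) by rewrite -exprSr prednK.
rewrite -!mulrA ler_pM2l ?exprn_gt0 // [X in X <= _]mulrC expr2 -!mulrA ler_pM2l // ler_pM2l //.
rewrite -big_split /= big_seq [X in _ <= X]big_seq; apply: ler_prod => p pc.
have [pr _ p2] := odd_prime_gt2 oc pc; have [h1 h2] := fp_bounds p2.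
by rewrite (le_trans _ h1) //= mulrC.
Qed.

Lemma mass_genus n (G : 'M[rat]_n) K w w' :
  genus G K w = genus G K w' -> mass G K w = mass G K w'.
Proof. by rewrite /mass => ->. Qed.

Lemma mass_ratio_ge (l : nat) (G E : 'M[rat]_l) (a : 'I_l -> nat) (u : 'rV[rat]_l) (c : nat) :
  (0 < l)%N -> E \in unitmx -> (forall j, (0 < a j)%N) ->
  (forall x : 'rV[rat]_l, qform G (x *m E) = \sum_(j < l) (a j)%:R * x 0 j ^+ 2) ->
  primitive (zspan E) u -> odd c ->
  gcdn (gcdn (\prod_(j < l) a j) `|numq (qform G u)|) c = 1%N ->
  c%:R ^+ l.-1 * \prod_(p <- primes c) fp p
    <= mass G (zspan E) (c%:R^-1 *: u) / mass G (zspan E) 0.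
Proof.
move=> l0 EU a0 /gram_diag gram prim oc g1; set A := diag_mx _ in gram.
have m0 := mass_gt0 EU gram a0 (erefl A).
have [z _ uE] := prim.1; rewrite -uE in prim g1 *.
have [c1|c1|c1] := ltngtP c 1; first by case: c c1 oc {g1}.
  rewrite (ler_pdivlMr _ _ m0).
  apply: le_trans (mass_ratio EU gram a0 (erefl A) z c1).
  rewrite (ler_pM2r m0); apply: (unit_vectors_ge _ l0 c1 oc); first exact: tr_diag_mx.
  exact: good_vector_mod gram prim oc g1.
(* c = 1 is treated apart because ['Z_1] has two elements. Here the shift is integral and both
   genera coincide, so the ratio is 1. *)
rewrite c1 expr1n big_nil mulr1 (ler_pdivlMr _ _ m0) mul1r.
suff gE : genus G (zspan E) 0 = genus G (zspan E) (1%:R^-1 *: (map_mx intr z *m E)).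
  by rewrite (mass_genus gE); exact: lexx.
rewrite (zero_shift E).
have sub z1 z2 X : genus G (zspan E) (1%:R^-1 *: (map_mx intr z1 *m E)) X ->
    genus G (zspan E) (1%:R^-1 *: (map_mx intr z2 *m E)) X.
  move=> /(genus_coord z1 EU gram (ltn0Sn 0))[E' [A' [z' [E'U E'A XE loc]]]].
  apply/(genus_coord z2 EU gram (ltn0Sn 0)); exists E', A', z'; split=> // p pr.
  have [U [UU UA _]] := loc p pr; exists U; split=> //.
  by exists (map_mx intr z2 *m U - map_mx intr z'); rewrite scale1r addrC subrK.
by apply/seteqP; split=> X; exact: sub.
Qed.

(** Primes p >= 9^(1/delta) satisfy p^(-delta) <= 1/9 <= f_p. Fewer than P + 1 prime factors of c
    lie below the threshold P, each costing a factor of at most 9; hence the constant 9^(-P), which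
    depends on delta alone. *)
Lemma prod_fp_ge (R : realType) (delta : R) : 0 < delta ->
  exists2 C : R, 0 < C & forall c, odd c ->
    C * c%:R `^ (- delta) <= ratr (\prod_(p <- primes c) fp p).
Proof.
move=> d0; pose P := (Num.truncn (9%:R `^ delta^-1)).+1.
exists (9%:R^-1 ^+ P); first by rewrite exprn_gt0 // invr_gt0 ltr0n.
move=> c oc; have c0 : (0 < c)%N by case: c oc.
have big_p p : (P <= p)%N -> p%:R `^ (- delta) <= 9%:R^-1 :> R.
  move=> Pp; rewrite powRN lef_pV2 ?posrE ?powR_gt0 ?ltr0n //; last by apply: leq_trans Pp.
  have e9 : 9%:R = (9%:R `^ delta^-1) `^ delta :> R.
    by rewrite -powRrM mulVf ?gt_eqF // powRr1.
  rewrite e9; apply: ge0_ler_powR; rewrite ?ltW // ?nnegrE ?powR_ge0 ?ler0n //.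
  by rewrite (lt_le_trans (truncnS_gt _)) // ler_nat.
have le1 p : (0 < p)%N -> p%:R `^ (- delta) <= 1 :> R.
  move=> p0; rewrite powRN invf_le1 ?powR_gt0 ?ltr0n //.
  by rewrite -[X in X <= _](powRr0 p%:R) ler_powR ?ler1n // ltW.
have fpR p : (2 < p)%N -> 9%:R^-1 <= ratr (fp p) :> R.
  move=> /fp_bounds[h _]; have := ler_rat R 9%:R^-1 (fp p).
  by rewrite h fmorphV /= ratr_nat.
have small : 9%:R^-1 ^+ P <= \prod_(p <- primes c) (if (p < P)%N then 9%:R^-1 else 1) :> R.
  rewrite -big_mkcond big_const_seq iter_mulr_1.
  apply: ler_wiXn2l; rewrite ?invr_ge0 ?ler0n ?invf_le1 ?ltr0n ?ler1n //.
  rewrite -size_filter -[P in X in (_ <= X)%N](size_iota 0).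
  apply: uniq_leq_size; first by rewrite filter_uniq // primes_uniq.
  by move=> p; rewrite mem_filter mem_iota => /andP[].
(* Passing from c to the product of its prime factors increases the power with exponent -delta, and
   so allows a comparison factor by factor. *)
have powD : c%:R `^ (- delta) <= \prod_(p <- primes c) p%:R `^ (- delta) :> R.
  have -> : \prod_(p <- primes c) p%:R `^ (- delta) = (\prod_(p <- primes c) p)%:R `^ (- delta) :> R.
    elim: (primes c) => [|p s IH]; first by rewrite !big_nil powR1.
    by rewrite !big_cons natrM powRM ?ler0n // IH.
  have Dc := prod_primes_dvd c0; have D0 := dvdn_gt0 c0 Dc.
  rewrite !powRN lef_pV2 ?posrE ?powR_gt0 ?ltr0n //.
  apply: ge0_ler_powR; [exact: ltW|by rewrite nnegrE ler0n|by rewrite nnegrE ler0n|].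
  by rewrite ler_nat dvdn_leq.
apply: (@le_trans _ _ ((\prod_(p <- primes c) (if (p < P)%N then 9%:R^-1 else 1)) *
   \prod_(p <- primes c) p%:R `^ (- delta))).
  by apply: ler_pM => //; rewrite ?powR_ge0 // exprn_ge0 // invr_ge0.
rewrite -big_split /= rmorph_prod big_seq [X in _ <= X]big_seq; apply: ler_prod => p pc.
have [pr _ p2] := odd_prime_gt2 oc pc.
have [pP|pP] := ltnP p P.
  rewrite mulr_ge0 ?powR_ge0 ?invr_ge0 ?ler0n //=; apply: le_trans (fpR p p2).
  by rewrite ler_piMr ?invr_ge0 ?ler0n // le1 // prime_gt0.
by rewrite mul1r powR_ge0 /= (le_trans (big_p p pP)) // fpR.
Qed.

Theorem theorem6p4 (R : realType) :
  (forall (l : nat) (G E : 'M[rat]_l) (a : 'I_l -> nat)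
          (u : 'rV[rat]_l) (c : nat),
     (3 <= l)%N ->
     E \in unitmx ->
     (forall j, (0 < a j)%N) ->
     (forall x : 'rV[rat]_l,
        qform G (x *m E) = \sum_(j < l) (a j)%:R * x 0 j ^+ 2) ->
     primitive (zspan E) u ->
     qform G u != 0 ->
     odd c ->
     gcdn (gcdn (\prod_(j < l) a j) `|numq (qform G u)|) c = 1%N ->
     c%:R ^+ l.-1 * \prod_(p <- primes c) fp p
       <= mass G (zspan E) (c%:R^-1 *: u) / mass G (zspan E) 0)
  /\
  (forall delta : R, 0 < delta ->
   exists2 C : R, 0 < C &
   forall (l : nat) (G E : 'M[rat]_l) (a : 'I_l -> nat)
          (u : 'rV[rat]_l) (c : nat),
     (3 <= l)%N ->
     E \in unitmx ->
     (forall j, (0 < a j)%N) ->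
     (forall x : 'rV[rat]_l,
        qform G (x *m E) = \sum_(j < l) (a j)%:R * x 0 j ^+ 2) ->
     primitive (zspan E) u ->
     qform G u != 0 ->
     odd c ->
     gcdn (gcdn (\prod_(j < l) a j) `|numq (qform G u)|) c = 1%N ->
     C * c%:R `^ (l%:R - 1 - delta)
       <= ratr (mass G (zspan E) (c%:R^-1 *: u) / mass G (zspan E) 0)).
Proof.
split=> [l G E a u c l3 EU a0 HQ up _ oc g1|delta d0].
  exact: (mass_ratio_ge (leq_trans _ l3) EU a0 HQ up oc g1).
have [C C0 HC] := prod_fp_ge d0; exists C; first exact: C0.
move=> l G E a u c l3 EU a0 HQ up _ oc g1; have c0 : (0 < c)%N by case: c oc {g1 HC}.
have l0 : (0 < l)%N by apply: leq_trans l3.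
have := mass_ratio_ge l0 EU a0 HQ up oc g1; rewrite -(ler_rat R).
apply: le_trans; rewrite rmorphM rmorphXn /= ratr_nat.
have -> : l%:R - 1 - delta = l.-1%:R - delta :> R by rewrite -subn1 natrB.
rewrite powRD; last by apply/implyP => _; rewrite pnatr_eq0 -lt0n.
rewrite powR_mulrn ?ler0n // mulrCA ler_wpM2l ?exprn_ge0 ?ler0n //.
exact: HC.
Qed.
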